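(* The three series $\varphi_1(x)$, $\psi_1(x)$ and $\mathcal{W}(x)$ converge for the same values of the real variable $x$. At every point of convergence $x$ one has $$\varphi_1(x)=\psi_1(x)=-\tfrac12\mathcal{W}(x)+G(x)+\delta(x),$$ where $\delta:\mathbb{R}\to\mathbb{R}$ is a $1$-periodic function vanishing on $\mathbb{R}\setminus\mathbb{Q}$ (given explicitly in the context).
   Context: $\{t\}$ is the fractional part of $t$. $B_1(t)=\{t\}-\frac12$ if $t\notin\mathbb{Z}$ and $B_1(t)=0$ if $t\in\mathbb{Z}$. $\tau(n)$ is the number of positive divisors of $n$. The series are $$\varphi_1(x)=\sum_{n\ge1}\frac{B_1(nx)}{n},\qquad \psi_1(x)=-\frac1\pi\sum_{n\ge1}\frac{\tau(n)}{n}\sin(2\pi nx).$$ Convergence means convergence of the partial sums. Let $X=(0,1)\setminus\mathbb{Q}$ and $\alpha(x)=\{1/x\}$; $\alpha_0(x)=x$, $\alpha_k(x)=\alpha(\alpha_{k-1}(x))$ for $k\ge1$; $\beta_{-1}=1$, $\beta_k(x)=\alpha_0(x)\alpha_1(x)\cdots\alpha_k(x)$; $\gamma_k(x)=\beta_{k-1}(x)\log(1/\alpha_k(x))$. These are defined for all $k\ge 0$ if $x\in X$. Every rational $r\in(0,1)$ can be written uniquely as $r=[0;b_1,\dots,b_K]$ with $K\ge1$, $b_i$ positive integers and $b_K\ge2$; $K$ is called the depth of $r$, and then $\alpha_k(r)$ is defined by the same recursion for $k\le K$, with $\alpha_K(r)=0$. The number $0$ has depth $0$. The series $\mathcal{W}(x)$: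 for $x\in X$, $\mathcal{W}(x)=\sum_{k\ge0}(-1)^k\gamma_k(x)$; for a rational $r\in(0,1)$ of depth $K$, $\mathcal{W}(r)=\sum_{0\le k<K}(-1)^k\gamma_k(r)$ (a finite sum, hence convergent); $\mathcal{W}(0)=0$; and $\mathcal{W}(x)=\mathcal{W}(\{x\})$ for all real $x$. Let $A(\lambda)=\int_0^\infty\{t\}\{\lambda t\}\,t^{-2}dt$ for $\lambda\ge0$, and $F(x)=\frac{x+1}{2}A(1)-A(x)-\frac x2\log x$ for $x>0$, $F(0)=A(1)/2$. Define $G(x)=\sum_{j\ge0}(-1)^j\beta_{j-1}(x)F(\alpha_j(x))$ for $x\in X$; $G(r)=\sum_{0\le j\le K}(-1)^j\beta_{j-1}(r)F(\alpha_j(r))$ for $r\in[0,1)$ rational of depth $K$; and extend $G$ to $\mathbb{R}$ by $1$-periodicity. The function $\delta:\mathbb{R}\to\mathbb{R}$ is $1$-periodic, $\delta(x)=0$ for $x\in X$, and $\delta(p/q)=\dfrac{(-1)^{K+1}A(1)}{2q}$ for a rational $p/q\in[0,1)$ in lowest terms of depth $K$. *)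

(* Defs.v *)
From mathcomp Require Import all_boot all_order all_algebra.
From mathcomp Require Import all_classical all_reals all_analysis.

Set Implicit Arguments.
Unset Strict Implicit.
Unset Printing Implicit Defensive.

Import Order.TTheory GRing.Theory Num.Theory.
Import numFieldNormedType.Exports.

Local Open Scope classical_set_scope.
Local Open Scope ring_scope.

Section Definitions.
Context {R : realType}.
Implicit Types (x y t l : R) (k j n : nat).

Definition frac t : R := t - (Num.floor t)%:~R.

Definition B1 t : R := if t \is a Num.int then 0 else frac t - 2^-1.

Definition tau n : nat := size (divisors n).

(* The sequences of terms below are indexed from 0, so that index k stands for
   n = k + 1 in the series over n >= 1. *)
Definition phi1_term x : R^nat := fun k => B1 (k.+1%:R * x) / k.+1%:R.

Definition psi1_term x : R^nat := fun k =>
  - pi^-1 * ((tau k.+1)%:R / k.+1%:R * sin (2 * pi * k.+1%:R * x)).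

Definition phi1 x : R := limn (series (phi1_term x)).
Definition psi1 x : R := limn (series (psi1_term x)).

(* [alpha k x] is the k-th iterate of x |-> {1/x}. As 0^-1 = 0 it is total, but
   for a rational x of depth K only the indices k <= K are used below. *)
Definition alpha k x : R := iter k (fun y => frac y^-1) x.

(* The index is shifted: [beta k x] is alpha_0(x) ... alpha_(k-1)(x), usually
   written beta_(k-1)(x), so that [beta 0 x] = 1. *)
Definition beta k x : R := \prod_(i < k) alpha i x.

Definition gamma k x : R := beta k x * ln (alpha k x)^-1.

(* [contfrac [:: b_1; ...; b_K]] is [0; b_1, ..., b_K]. *)
Definition contfrac (b : seq nat) : R :=
  foldr (fun (a : nat) t => (a%:R + t)^-1) 0 b.

Definition has_depth y (K : nat) : Prop :=
  exists b : seq nat,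
    [/\ size b = K, all (fun a => 0 < a)%N b,
        b = [::] \/ (1 < last 0 b)%N & y = contfrac b].

(* Meaningful for rational y in [0, 1): such a y has exactly one depth, the
   depth of 0 being given by the empty expansion. *)
Definition depth y : nat := xget 0%N [set K | has_depth y K].

(* The positive denominator of a rational y in lowest terms. *)
Definition denom y : R := (denq (xget 0 [set r : rat | ratr r = y]))%:~R.

(* At a rational point the sum is over k < depth; it is encoded as a series
   whose remaining terms are 0. *)
Definition W_term x : R^nat := fun k =>
  let y := frac x in
  if `[< rational y >] && (depth y <= k)%N then 0 else (-1) ^+ k * gamma k y.

Definition W x : R := limn (series (W_term x)).

Definition A l : R :=
  \int[lebesgue_measure]_(t in `[0%R, +oo[) (frac t * frac (l * t) / t ^+ 2).

Definition F x : R :=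
  if x == 0 then A 1 / 2 else (x + 1) / 2 * A 1 - A x - x / 2 * ln x.

Definition G_term y : R^nat := fun j => (-1) ^+ j * beta j y * F (alpha j y).

Definition G x : R :=
  let y := frac x in
  if `[< rational y >] then \sum_(j < (depth y).+1) G_term y j
  else limn (series (G_term y)).

Definition delta x : R :=
  let y := frac x in
  if `[< rational y >] then (-1) ^+ (depth y).+1 * A 1 / (2 * denom y) else 0.

End Definitions.

(* Main.v *)
Require Import Defs.
From mathcomp Require Import all_boot all_order all_algebra.
From mathcomp Require Import all_classical all_reals all_analysis.
From mathcomp Require Import ring lra zify.
(* [frac] is the fractional part here, not the map into a field of fractions. *)
Import Defs.
Import Order.TTheory GRing.Theory Num.Theory.
Import numFieldNormedType.Exports.
Set Implicit Arguments.
Unset Strict Implicit.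
Unset Printing Implicit Defensive.
Local Open Scope classical_set_scope.
Local Open Scope ring_scope.

(** Both series are compared, at a finite cutoff, with the partial sums of the
expansion of [x] along the Gauss map.

Write [S(x, v)] for the sum of the terms [n <= v] of [phi1 x]. The integral of
[{t} {x t} / t^2] over [0 < t <= v] can be evaluated exactly: replacing [{t}]
by [t - [t]] and the integer parts by sums of step functions leaves elementary
sums and the double sum of [min (1 / n, x / m)] over [n <= v], [m <= x v].
Splitting the latter according to which term is the minimum makes [S(x, v)] and
[S(1 / x, x v)] appear. Since the whole integral is [A x], this gives the
reciprocity law ([phi_reciprocity])

  [S(x, v) + x S(1 / x, x v) = F(x) - log (1 / x) / 2 + O(1 / (x v))].

The instance [x = 1], where [S] vanishes, plays the role of Stirling's formula.
As [B1] has period 1, [1 / x] may be replaced by its fractional part and the law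
iterated ([phi_iterate]): after [K] steps, [S(x, v)] is the [K]-th partial sum
of [G - W / 2] ([gauss_sum]) plus the signed remainder
[beta_K S(alpha_K, beta_K v)], with an accumulated error that decays
geometrically in [K] as long as [beta_K v >= 1]. The remainder is at most
[beta_K (1 + log (beta_K v))].

For [psi1], the divisor sum up to [N] is rearranged by the hyperbola method; its
inner sums are partial sums of the Fourier series of [B1], whose error is
controlled by the Dirichlet kernel ([sawtooth_err]). With [w] the integer part
of the square root of [N], the partial sum of [psi1] up to [N] differs from
that of [phi1] up to [w] by at most a constant times the sum over [m <= w] of
[min (1, 1 / (w ||m x||)) / m] ([psi1_sub_phi1]). The multiples of [x] are
spaced by [beta_K] in blocks whose length is the denominator of a convergent
([convergent_spacing]), so this sum is [o(1)] plus a multiple of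
[beta_K (1 + log (beta_K w))] ([spaced_sum], [one_sided_sum]).

For irrational [x], both series are therefore within
[o(1) + O(beta_K (1 + log (beta_K w)))] of [gauss_sum x K] whenever
[beta_K w >= 1] ([tracks]). If [W] converges then [gamma] tends to 0; choosing
[K] with [beta_(K+1) w < 1 <= beta_K w] bounds the error by
[o(1) + O(gamma_K)], and both series converge to [G - W / 2]. Conversely, at
the cutoffs [w] close to [1 / beta_K] the logarithm is bounded, so the
convergence of either series forces that of [gauss_sum], hence of [W].

For rational [x] the iteration ends with [alpha_K = 0], where [S] vanishes, so
both series converge to [gauss_sum x K]. Here [G] has one more term,
[(-1)^K beta_K F(0)] with [F(0) = A(1) / 2] and [beta_K] the inverse of the
denominator, and [delta] removes it. *)

(** * Integrals of step functions *)

Section HasIntegral.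
Context {R : realType}.
Implicit Types (f g : R -> R) (v I c : R).
Notation mu := (@lebesgue_measure R).

(** Integrability and the value are kept together, so that linear combinations
    carry both. The interval is open at 0 because the expanded integrand below has
    the right value only for [t > 0]. *)
Definition has_int v f I :=
  mu.-integrable `]0, v] (EFin \o f) /\ \int[mu]_(t in `]0, v]) f t = I.

Lemma eq_has_int v f g I : {in `]0, v], f =1 g} ->
  has_int v f I -> has_int v g I.
Proof.
move=> fg [fi fI]; split.
  apply: eq_integrable fi => //= t; rewrite inE /= => tv.
  by rewrite fg.
rewrite -fI; apply: eq_Rintegral => t; rewrite inE /= => tv.
by rewrite fg.
Qed.

Lemma has_intD v f g I J : has_int v f I -> has_int v g J ->
  has_int v (fun t => f t + g t) (I + J).
Proof.
move=> [fi fI] [gi gJ]; split; last by rewrite RintegralD // fI gJ.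
have -> : EFin \o (fun t => f t + g t) = ((EFin \o f) \+ (EFin \o g))%E by [].
exact: integrableD.
Qed.

Lemma has_intZ v f I (a : R) : has_int v f I ->
  has_int v (fun t => a * f t) (a * I).
Proof.
move=> [fi fI]; split; last by rewrite RintegralZl // fI.
have -> : EFin \o (fun t => a * f t) = (fun t => a%:E * (EFin \o f) t)%E by [].
exact: integrableZl.
Qed.

Lemma has_int0 v : has_int v (fun=> 0) 0.
Proof.
split; first exact: integrable0.
by rewrite Rintegral_cst //= mul0r.
Qed.

Lemma has_int_sum v n (f : nat -> R -> R) (I : nat -> R) :
  (forall k, (k < n)%N -> has_int v (f k) (I k)) ->
  has_int v (fun t => \sum_(0 <= k < n) f k t) (\sum_(0 <= k < n) I k).
Proof.
elim: n => [|n IHn] h.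
  rewrite big_geq //.
  by apply: eq_has_int (has_int0 v) => t _; rewrite big_geq.
rewrite big_nat_recr //=.
apply: (@eq_has_int _ (fun t => \sum_(0 <= k < n) f k t + f n t)).
  by move=> t _; rewrite big_nat_recr.
apply: has_intD; last exact: h.
by apply: IHn => k kn; apply: h; rewrite ltnS ltnW.
Qed.

Lemma has_int_cst v (a : R) : 0 <= v -> has_int v (cst a) (a * v).
Proof.
move=> v0; split.
  apply: (@integrableS _ _ _ mu `[0, v]%classic) => //.
    by apply: subset_itvr; rewrite bnd_simp.
  apply: continuous_compact_integrable; first exact: segment_compact.
  by apply: continuous_subspaceT => t; exact: cvg_cst.
rewrite Rintegral_cst //= lebesgue_measure_itv /= lte_fin.
by case: ltgtP v0 => //= [v0|<-] _; rewrite ?subr0 // mulr0.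
Qed.

Definition step c t : R := (c <= t)%R%:R.

Lemma has_int_step v c f F : 0 < c <= v ->
  (forall t : R, c <= t -> is_derive t 1 F (f t)) ->
  (forall t : R, c <= t -> derivable f t 1) ->
  has_int v (fun t => step c t * f t) (F v - F c).
Proof.
move=> /andP[c0 cv] dF df.
have cvI : `]0, v] `&` `[c, v] = `[c, v]%classic.
  apply/seteqP; split => t /=; rewrite !in_itv /=; first by case.
  by move=> /andP[ct ->]; rewrite ct (lt_le_trans c0 ct).
have cf : {within `[c, v], continuous f}.
  apply: derivable_within_continuous => t; rewrite in_itv /= => /andP[ct _].
  exact: df.
have fE : {in `]0, v], f \_ `[c, v] =1 (fun t => step c t * f t)}.
  move=> t; rewrite in_itv /= => /andP[_ tv]; rewrite patchE /step.
  have -> : (t \in `[c, v]%classic) = (c <= t).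
    by apply/idP/idP; rewrite inE /= in_itv /= tv andbT.
  by case: (c <= t); rewrite ?mul1r ?mul0r.
apply: (eq_has_int fE); split.
  rewrite -restrict_EFin; apply/integrable_restrict => //=; rewrite cvI.
  by apply: continuous_compact_integrable => //; exact: segment_compact.
rewrite -Rintegral_mkcondr cvI.
move: cv; rewrite le_eqVlt => /orP[/eqP <-|cv].
  by rewrite set_itv1 Rintegral_set1 subrr.
rewrite /Rintegral (continuous_FTC2 cv cf (F := F)) //.
- have Fc t : c <= t -> {for t, continuous F}.
    move=> /dF [dFt _].
    exact/differentiable_continuous/derivable1_diffP.
  split.
  + by move=> t; rewrite in_itv /= => /andP[/ltW/dF[]].
  + by apply: cvg_at_right_filter; exact: Fc.
  + by apply: cvg_at_left_filter; apply: Fc; exact: ltW.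
- move=> t; rewrite in_itv /= => /andP[/ltW ct _].
  by have := dF _ ct => d; rewrite derive1E; exact: derive_val.
Qed.

End HasIntegral.

(** * Fractional parts *)

Section FractionalPart.
Context {R : realType}.
Implicit Types (x y t v : R) (n k : nat).

Lemma frac_ge0 t : 0 <= frac t.
Proof. by rewrite subr_ge0; case/andP: (floor_itv t). Qed.

Lemma frac_lt1 t : frac t < 1.
Proof. by rewrite ltrBlDl; case/andP: (floor_itv t); rewrite intrD. Qed.

Lemma frac_truncn t : 0 <= t -> frac t = t - (Num.truncn t)%:R.
Proof.
move=> t0; rewrite /frac; congr (_ - _).
by rewrite truncn_floor t0 natr_absz ger0_norm // floor_ge0.
Qed.

Lemma frac_id t : 0 <= t < 1 -> frac t = t.
Proof.
move=> /andP[t0 t1]; rewrite frac_truncn // (_ : Num.truncn t = 0%N) ?subr0 //.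
by apply/truncn0Pn; rewrite -ltNge.
Qed.

Lemma fracDz t (m : int) : frac (t + m%:~R) = frac t.
Proof.
rewrite /frac floorDrz ?intr_int // intrD intrKfloor.
by rewrite opprD addrACA subrr addr0.
Qed.

Lemma frac_eq0 t : (frac t == 0) = (t \is a Num.int).
Proof. by rewrite subr_eq0 eq_sym intrEfloor. Qed.

Lemma B1Dz t (m : int) : B1 (t + m%:~R) = B1 t.
Proof.
rewrite /B1 fracDz; congr (if _ then _ else _).
by rewrite -!frac_eq0 fracDz.
Qed.

Lemma normB1_le t : `|B1 t| <= 2^-1.
Proof.
rewrite /B1; case: ifP => _; first by rewrite normr0 invr_ge0.
have := frac_ge0 t; have := frac_lt1 t; rewrite ler_norml; lra.
Qed.

Lemma sum_ltn n k : (k <= n)%N -> \sum_(0 <= i < n) (i < k)%:R = k%:R :> R.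
Proof.
move=> kn; rewrite (big_cat_nat _ kn) //= [X in _ + X]big_nat_cond.
rewrite [X in _ + X]big1 ?addr0 => [|i /andP[/andP[ki _] _]]; last by rewrite ltnNge ki.
rewrite big_nat_cond (eq_bigr (fun=> 1)) => [|i /andP[/andP[_ ->]]] //.
by rewrite -big_nat_cond sumr_const_nat subn0.
Qed.

Lemma truncn_sum n t : 0 <= t -> (Num.truncn t <= n)%N ->
  (Num.truncn t)%:R = \sum_(0 <= k < n) (k.+1%:R <= t)%R%:R :> R.
Proof.
move=> t0 tn; rewrite -(sum_ltn tn); apply: eq_bigr => k _.
by rewrite truncn_gt_nat.
Qed.

(** Half of each strict and each weak comparison: the convention for
    counting points on the diagonal that produces [B1]. *)
Definition half_le x y : R := ((x < y)%R%:R + (x <= y)%R%:R) / 2.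

Lemma sum_half_le n y : 0 < y -> (Num.truncn y <= n)%N ->
  \sum_(0 <= k < n) half_le k.+1%:R y = y - 2^-1 - B1 y.
Proof.
move=> y0 yn; rewrite /half_le -mulr_suml big_split /= -truncn_sum ?ltW //.
rewrite /B1; case: ifPn => yint.
  have : y \is a Num.nat by rewrite -intrEge0 // ltW.
  move=> /natrP[m ym]; rewrite ym in y0 yn *.
  rewrite natrK in yn *; case: m y0 yn {ym} => [|m]; first by rewrite ltxx.
  move=> _ mn; rewrite (eq_bigr (fun k => (k < m)%:R)); last first.
    by move=> k _; rewrite ltr_nat ltnS.
  by rewrite sum_ltn ?(ltnW mn) // -natr1; field.
rewrite (eq_bigr (fun k => (k.+1%:R <= y)%R%:R)); last first.
  move=> k _; rewrite le_eqVlt orbC; case: (ltP _ y) => //= _.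
  by case: eqP => // ky; rewrite -ky rpred_nat in yint.
by rewrite -truncn_sum ?ltW // frac_truncn ?(ltW y0) //; field.
Qed.

End FractionalPart.

(** * The truncated autocorrelation integral *)

Section Truncation.
Context {R : realType}.
Implicit Types (x y t v : R) (n k : nat).
Notation fl := Num.truncn.

Definition harm n : R := \sum_(0 <= k < n) k.+1%:R^-1.

Definition logsum v : R := \sum_(0 <= k < fl v) ln (v / k.+1%:R).

(** The cutoff is a real number, since the reciprocity law multiplies it by [x]. *)
Definition phiS x v : R := series (phi1_term x) (fl v).

Definition autocorr x t : R := frac t * frac (x * t) / t ^+ 2.

(** The minimum of [1 / n] and [x / m] is [1 / n] for [m < n x] and [x / m] for
    [n < m / x]; on the diagonal [m = n x] the two are equal and each is given
    weight one half. *)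
Lemma inv_max_half_le x (i j : nat) : 0 < x ->
  (Num.max i.+1%:R (j.+1%:R / x))^-1 =
  i.+1%:R^-1 * half_le j.+1%:R (i.+1%:R * x) +
  x * (j.+1%:R^-1 * half_le i.+1%:R (j.+1%:R * x^-1)).
Proof.
move=> x0; rewrite /half_le -ltr_pdivrMr // -ler_pdivrMr //.
have x00 : x != 0 by rewrite gt_eqF.
have i0 : i.+1%:R != 0 :> R by rewrite pnatr_eq0.
have j0 : j.+1%:R != 0 :> R by rewrite pnatr_eq0.
move: i.+1%:R j.+1%:R i0 j0 => a b a0 b0.
by case: (ltgtP (b / x) a) => [ba|ba|<-] /=; rewrite ?mulr0n; field;
  rewrite ?a0 ?b0 ?x00.
Qed.

(** Summing over the other variable first, each half of the double sum counts
    the integers below [n x], respectively [m / x]; the range is long enough because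
    [n <= v] implies [n x <= x v], and conversely. *)
Lemma sum_inv_max x v : 0 < x -> 0 < v ->
  \sum_(0 <= i < fl v) \sum_(0 <= j < fl (x * v))
    (Num.max i.+1%:R (j.+1%:R / x))^-1 =
  x * (fl v)%:R + (fl (x * v))%:R - harm (fl v) / 2
  - x / 2 * harm (fl (x * v)) - phiS x v - x * phiS x^-1 (x * v).
Proof.
move=> x0 v0.
have xv0 : 0 < x * v by rewrite mulr_gt0.
under eq_bigr do under eq_bigr do rewrite inv_max_half_le //.
under eq_bigr do rewrite big_split /=.
rewrite big_split /= [X in _ + X]exchange_big_nat /=.
rewrite (@eq_big_nat _ _ _ 0 (fl v) _ (fun i =>
    x - i.+1%:R^-1 / 2 - phi1_term x i)); last first.
  move=> i /andP[_ iv]; rewrite -mulr_sumr sum_half_le ?mulr_gt0 //; last first.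
    apply: le_truncn; rewrite mulrC ler_pM2l //.
    by rewrite -truncn_ge_nat // ltW.
  rewrite /phi1_term !mulrBr mulrA mulVf ?pnatr_eq0 // mul1r.
  by rewrite [B1 _ * _]mulrC.
rewrite (@eq_big_nat _ _ _ 0 (fl (x * v)) _ (fun j =>
    1 - x * (j.+1%:R^-1 / 2) - x * phi1_term x^-1 j)); last first.
  move=> j /andP[_ jv]; rewrite -mulr_sumr -mulr_sumr.
  rewrite sum_half_le ?divr_gt0 //; last first.
    apply: le_truncn; rewrite ler_pdivrMr // mulrC.
    by rewrite -truncn_ge_nat // ltW.
  rewrite /phi1_term; have : j.+1%:R != 0 :> R by rewrite pnatr_eq0.
  have : x != 0 by rewrite gt_eqF.
  by move: j.+1%:R (B1 _) => a b x00 a0; field; rewrite ?x00 ?a0.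
rewrite !sumrB !sumr_const_nat !subn0 -!mulr_sumr -!mulr_suml.
rewrite -[x *+ _]mulr_natr -!/(harm _) /phiS /series /=.
by rewrite -[1 *+ _]/(_%:R); field.
Qed.

(** For [t > 0] the integrand is [x - x [t] / t - [x t] / t + [t] [x t] / t^2],
    and the integer parts are sums of step functions, so that only antiderivatives
    of [1 / t] and [1 / t^2] are needed. *)
Lemma int_autocorr x v : 0 < x -> 0 < v ->
  has_int v (autocorr x)
   (x * v - x * logsum v - logsum (x * v) +
    \sum_(0 <= i < fl v) \sum_(0 <= j < fl (x * v))
      (Num.max i.+1%:R (j.+1%:R / x))^-1 -
    (fl v)%:R * (fl (x * v))%:R / v).
Proof.
move=> x0 v0.
have xv0 : 0 < x * v by rewrite mulr_gt0.
have hinv c : 0 < c <= v -> has_int v (fun t => step c t * t^-1) (ln (v / c)).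
  move=> /[dup] /andP[c0 _] cv; rewrite ln_div ?posrE //.
  apply: has_int_step => // t ct.
    by apply: is_derive1_ln; exact: lt_le_trans ct.
  by apply: derivableV; rewrite ?gt_eqF // (lt_le_trans c0).
have hinv2 c : 0 < c <= v ->
    has_int v (fun t => step c t * t ^- 2) (c^-1 - v^-1).
  move=> /[dup] /andP[c0 _] cv; rewrite -[c^-1 - _]addrC -[c^-1]opprK.
  apply: (has_int_step (F := fun t => - t^-1)) => // t ct.
    have t0 : t != 0 by rewrite gt_eqF // (lt_le_trans c0).
    apply: is_derive_eq; first by apply: is_deriveN; apply: is_deriveV.
    by rewrite scaleNr opprK /GRing.scale /= mulr1.
  have t0 : t != 0 by rewrite gt_eqF // (lt_le_trans c0).
  apply: derivableV; first by rewrite expf_neq0.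
  exact: exprn_derivable.
have vb i : (i < fl v)%N -> 0 < (i.+1%:R : R) <= v.
  by move=> iv; rewrite ltr0n /= -truncn_ge_nat // ltW.
have xvb j : (j < fl (x * v))%N -> 0 < j.+1%:R / x <= v.
  move=> jv; rewrite divr_gt0 //= ler_pdivrMr // mulrC -truncn_ge_nat //.
  exact: ltW.
have mvb i j : (i < fl v)%N -> (j < fl (x * v))%N ->
    0 < Num.max i.+1%:R (j.+1%:R / x) <= v.
  move=> iv jv; have /andP[i0 iv'] := vb i iv; have /andP[j0 jv'] := xvb j jv.
  by rewrite lt_max i0 /= ge_max iv' jv'.
have H1 := has_int_cst x (ltW v0).
have H2 := has_int_sum (fun i iv => hinv _ (vb i iv)).
have H3 := has_int_sum (fun j jv => hinv _ (xvb j jv)).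
have H4 := has_int_sum (fun i iv => has_int_sum (fun j jv =>
  hinv2 _ (mvb i j iv jv))).
have H := has_intD (has_intD (has_intD H1 (has_intZ (- x) H2))
  (has_intZ (- 1) H3)) H4.
set I := (X in has_int _ _ X) in H.
rewrite (_ : _ - _ = I).
  apply: eq_has_int H => t; rewrite in_itv /= => /andP[t0 tv].
  have xt0 : 0 < x * t by rewrite mulr_gt0.
  rewrite /autocorr !frac_truncn ?ltW // -!mulr_suml.
  rewrite (@truncn_sum _ (fl v) t) ?ltW ?le_truncn //.
  rewrite (@truncn_sum _ (fl (x * v)) (x * t)) ?ltW ?le_truncn //; last first.
    by rewrite ler_pM2l.
  rewrite [X in _ + X = _](_ : _ = (\sum_(0 <= k < fl v) (k.+1%:R <= t)%R%:R) *
    (\sum_(0 <= k < fl (x * v)) (k.+1%:R <= x * t)%R%:R) * t ^- 2); last first.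
    rewrite mulr_suml mulr_suml; apply: eq_bigr => i _.
    rewrite mulr_sumr mulr_suml; apply: eq_bigr => j _.
    rewrite /step ge_max ler_pdivrMr // [t * x]mulrC.
    by rewrite -natrM mulnb.
  have -> : \sum_(0 <= j < fl (x * v)) step (j.+1%:R / x) t =
      \sum_(0 <= j < fl (x * v)) (j.+1%:R <= x * t)%R%:R.
    by apply: eq_bigr => j _; rewrite /step ler_pdivrMr // mulrC.
  by field; rewrite gt_eqF.
rewrite /I /logsum.
have -> : \sum_(0 <= i < fl v) \sum_(0 <= j < fl (x * v))
      ((Num.max i.+1%:R (j.+1%:R / x))^-1 - v^-1) =
    \sum_(0 <= i < fl v) \sum_(0 <= j < fl (x * v))
      (Num.max i.+1%:R (j.+1%:R / x))^-1 - (fl v)%:R * (fl (x * v))%:R / v.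
  under eq_bigr do rewrite sumrB sumr_const_nat subn0.
  rewrite sumrB sumr_const_nat subn0 -[_ *+ fl v]mulr_natl.
  by rewrite -[_ *+ fl (x * v)]mulr_natl mulrA.
have -> : \sum_(0 <= k < fl (x * v)) ln (x * v / k.+1%:R) =
    \sum_(0 <= k < fl (x * v)) ln (v / (k.+1%:R / x)).
  by apply: eq_bigr => k _; rewrite invf_div mulrCA mulrA.
by ring.
Qed.

Lemma autocorr_ge0 x t : 0 <= autocorr x t.
Proof. by rewrite divr_ge0 ?sqr_ge0 // mulr_ge0 ?frac_ge0. Qed.

Lemma autocorr_le x t : autocorr x t <= t ^- 2.
Proof.
rewrite /autocorr ler_piMl ?invr_ge0 ?exprn_even_ge0 //.
by rewrite mulr_ile1 ?frac_ge0 ?(ltW (frac_lt1 _)).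
Qed.

Lemma integral_invX2 v : 0 < v ->
  (\int[@lebesgue_measure R]_(t in `[v, +oo[) ((t ^- 2)%:E) = (v^-1)%:E)%E.
Proof.
move=> v0.
have d0 t : v <= t -> is_derive t 1 (fun t : R => - t^-1) (t ^- 2).
  move=> vt; have t0 : t != 0 by rewrite gt_eqF // (lt_le_trans v0).
  apply: is_derive_eq; first by apply: is_deriveN; apply: is_deriveV.
  by rewrite scaleNr opprK /GRing.scale /= mulr1.
rewrite (ge0_continuous_FTC2y (F := fun t => - t^-1) (l := 0)) //=.
- by rewrite -EFinB sub0r opprK.
- by move=> t _; rewrite invr_ge0 exprn_even_ge0.
- apply: derivable_within_continuous => t; rewrite in_itv /= andbT => vt.
  have t0 : t != 0 by rewrite gt_eqF // (lt_le_trans v0).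
  apply: derivableV; first by rewrite expf_neq0.
  exact: exprn_derivable.
- rewrite -oppr0; apply: cvgN; apply/gtr0_cvgV0; last exact: cvg_id.
  exact: nbhs_pinfty_gt.
- by move=> t /ltW /d0 [].
- apply: cvg_at_right_filter.
  have [dv _] := d0 v (lexx _).
  have cF : {for v, continuous (fun t : R => - t^-1)}.
    exact/differentiable_continuous/derivable1_diffP.
  exact: cF.
- move=> t; rewrite in_itv /= andbT => /ltW /d0 d.
  by rewrite derive1E; exact: derive_val.
Qed.

(** The integrand is nonnegative and at most [t^-2], which bounds the tail beyond
    [v]. Measurability on the whole half-line follows from that on the intervals
    where the integral was computed. *)
Lemma A_bounds x v I : 0 < x -> 0 < v -> has_int v (autocorr x) I ->
  I <= A x <= I + v^-1.
Proof.
move=> x0 v0 [hi hI].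
have mf : measurable_fun (`]0, +oo[%classic : set R) (autocorr x).
  rewrite itv_bndy_bigcup_BRight; apply/measurable_fun_bigcup => // k.
  rewrite add0r; case: k => [|k].
    by rewrite set_itv_ge ?bnd_simp //; exact: measurable_fun_set0.
  have [] := @int_autocorr x k.+1%:R x0; first by rewrite ltr0n.
  by move=> /measurable_int /measurable_realfun.measurable_EFinP.
have setE : `]0, +oo[%classic = (`]0, v] `|` `]v, +oo[ : set R).
  by rewrite -itv_bndbnd_setU // bnd_simp ltW.
have -> : A x = fine (\int[lebesgue_measure]_(t in `]0%R, +oo[) (autocorr x t)%:E)%E.
  by rewrite /A /Rintegral integral_itv_obnd_cbnd //; exact/measurable_realfun.measurable_EFinP.
rewrite setE ge0_integral_setU //=; last 3 first.
- by rewrite -setE; exact/measurable_realfun.measurable_EFinP.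
- by move=> t _; rewrite lee_fin autocorr_ge0.
- apply/disj_setPS => t [] /=; rewrite !in_itv /= andbT => /andP[_ tv].
  by rewrite ltNge tv.
have tail_ge0 : (0 <= \int[lebesgue_measure]_(t in `]v, +oo[) (autocorr x t)%:E)%E.
  by apply: integral_ge0 => t _; rewrite lee_fin autocorr_ge0.
have tail_le : (\int[lebesgue_measure]_(t in `]v, +oo[) (autocorr x t)%:E <= (v^-1)%:E)%E.
  rewrite -integral_invX2 // -integral_itv_obnd_cbnd; last first.
    apply: (@measurable_funS _ _ _ _ `[v, +oo[%classic) => //.
      by apply: subset_itvr; rewrite bnd_simp.
    apply/measurable_realfun.measurable_EFinP; apply: measurable_realfun.subspace_continuous_measurable_fun => //.
    apply: derivable_within_continuous => t; rewrite in_itv /= andbT => vt.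
    have t0 : t != 0 by rewrite gt_eqF // (lt_le_trans v0).
    apply: derivableV; first by rewrite expf_neq0.
    exact: exprn_derivable.
  apply: ge0_le_integral => //=.
  - by move=> t _; rewrite lee_fin autocorr_ge0.
  - apply/measurable_realfun.measurable_EFinP; apply: measurable_funS mf => //.
    by apply: subset_itvr; rewrite bnd_simp ltW.
  - apply: (@measurable_funS _ _ _ _ `[v, +oo[%classic) => //.
      by apply: subset_itvr; rewrite bnd_simp.
    apply/measurable_realfun.measurable_EFinP; apply: measurable_realfun.subspace_continuous_measurable_fun => //.
    apply: derivable_within_continuous => t; rewrite in_itv /= andbT => vt.
    have t0 : t != 0 by rewrite gt_eqF // (lt_le_trans v0).
    apply: derivableV; first by rewrite expf_neq0.
    exact: exprn_derivable.
  - by move=> t _; rewrite lee_fin autocorr_le.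
rewrite fineD; last 2 first.
- exact: integrable_fin_num hi.
- rewrite ge0_fin_numE //; exact: le_lt_trans tail_le (ltry _).
move: hI; rewrite /Rintegral => ->.
rewrite lerDl fine_ge0 //= lerD2l -lee_fin fineK //.
by rewrite ge0_fin_numE //; exact: le_lt_trans tail_le (ltry _).
Qed.

(** The exact formula behind the reciprocity law: the only estimate is that of
    the tail of the integral beyond [v]. *)
Lemma A_reciprocity x v : 0 < x -> 0 < v ->
  let I := x * v + x * (fl v)%:R + (fl (x * v))%:R
    - (fl v)%:R * (fl (x * v))%:R / v
    - x * (logsum v + harm (fl (x * v)) / 2) - (logsum (x * v) + harm (fl v) / 2)
    - phiS x v - x * phiS x^-1 (x * v) in
  I <= A x <= I + v^-1.
Proof.
move=> x0 v0; cbv zeta; set I := (X in X <= A x <= _); apply: A_bounds => //.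
suff -> : I = x * v - x * logsum v - logsum (x * v) +
    (\sum_(0 <= i < fl v) \sum_(0 <= j < fl (x * v))
      (Num.max i.+1%:R (j.+1%:R / x))^-1) -
    (fl v)%:R * (fl (x * v))%:R / v by exact: int_autocorr.
by rewrite sum_inv_max // /I; field; rewrite gt_eqF.
Qed.

End Truncation.

(** * Harmonic sums and the logarithm *)

Section Logarithm.
Context {R : realType}.
Implicit Types (x y u v : R) (n m : nat).
Notation fl := Num.truncn.

Lemma ln_le_sub1 x : 0 < x -> ln x <= x - 1.
Proof. by move=> x0; rewrite -{1}[x](subrKC 1) le_ln1Dx // ltrBrDl subrr. Qed.

Lemma ln_le x y : 0 < x -> x <= y -> ln x <= ln y.
Proof. by move=> x0 xy; rewrite ler_ln ?posrE // (lt_le_trans x0). Qed.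

Lemma harm0 : harm 0 = 0 :> R.
Proof. by rewrite /harm big_geq. Qed.

Lemma harmS n : harm n.+1 = harm n + n.+1%:R^-1 :> R.
Proof. by rewrite /harm big_nat_recr. Qed.

Lemma invS_le_ln n : (0 < n)%N -> n.+1%:R^-1 <= ln n.+1%:R - ln n%:R :> R.
Proof.
move=> n0; have n1 : 0 < n%:R :> R by rewrite ltr0n.
rewrite -opprB -ln_div ?posrE // lerNr.
apply: le_trans (ln_le_sub1 _) _; first by rewrite divr_gt0.
rewrite -[X in X / _](addrK 1) natr1 mulrBl divff ?pnatr_eq0 // mul1r.
by rewrite addrAC subrr sub0r.
Qed.

Lemma ln_le_inv n : (0 < n)%N -> ln n.+1%:R - ln n%:R <= n%:R^-1 :> R.
Proof.
move=> n0; have n1 : 0 < n%:R :> R by rewrite ltr0n.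
rewrite -ln_div ?posrE //; apply: le_trans (ln_le_sub1 _) _.
  by rewrite divr_gt0.
by rewrite -natr1 mulrDl divff ?gt_eqF // mul1r addrC addKr.
Qed.

Lemma harm_subln_le n m : (0 < m <= n)%N ->
  harm n - ln n%:R <= harm m - ln m%:R :> R.
Proof.
move=> /andP[m0 /subnK <-]; elim: (n - m)%N => [|k IHk] //.
apply: le_trans IHk; rewrite addSn harmS.
have := @invS_le_ln (k + m); rewrite addn_gt0 m0 orbT => /(_ isT) h.
by rewrite -addrA lerD2l lerBlDr addrC.
Qed.

Lemma harm_sublnS_ge n m : (m <= n)%N ->
  harm m - ln m.+1%:R <= harm n - ln n.+1%:R :> R.
Proof.
move=> /subnK <-; elim: (n - m)%N => [|k IHk] //.
apply: (le_trans IHk); rewrite addSn harmS.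
have h := @ln_le_inv (k + m).+1 isT.
by rewrite -addrA lerD2l lerBrDr addrC.
Qed.

Lemma harm_truncn_bounds m v : (0 < m)%N -> m%:R <= v ->
  harm m - ln m.+1%:R <= harm (fl v) - ln v <= harm m - ln m%:R.
Proof.
move=> m0 mv; have v0 : 0 < v by apply: lt_le_trans mv; rewrite ltr0n.
have mfl : (m <= fl v)%N by rewrite truncn_ge_nat // ltW.
have /andP[flv vfl] := truncn_itv (ltW v0).
have fl0 : 0 < (fl v)%:R :> R by rewrite ltr0n (leq_trans m0).
have := ln_le fl0 flv; have := ln_le v0 (ltW vfl).
have := harm_sublnS_ge mfl.
have := @harm_subln_le (fl v) m; rewrite m0 mfl => /(_ isT); lra.
Qed.

(** Both [harm n - ln n] (decreasing) and [harm n - ln (n + 1)] (increasing)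
    enclose the values at the two cutoffs, and they differ by at most the inverse of
    the integer part of [u]; for [u < 1] the logarithm of [u] itself is small
    compared with [1 / u]. *)
Lemma harm_sub_ln u v : 0 < u -> u <= v ->
  `|harm (fl v) - harm (fl u) - ln (v / u)| <= 2 / u.
Proof.
move=> u0 uv; have v0 := lt_le_trans u0 uv.
rewrite ln_div ?posrE //.
have u20 : 0 < u^-1 by rewrite invr_gt0.
have [u1|u1] := leP 1 u.
  have m0 : (0 < fl u)%N by rewrite truncn_gt0.
  have /andP[flu ufl] := truncn_itv (ltW u0).
  have := harm_truncn_bounds m0 flu.
  have := harm_truncn_bounds m0 (le_trans flu uv).
  have := ln_le_inv m0.
  have : (fl u)%:R^-1 <= 2 / u.
    have fl1 : 1 <= (fl u)%:R :> R by rewrite ler1n.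
    rewrite ler_pdivlMr // mulrC ler_pdivrMr ?(lt_le_trans ltr01) //.
    by move: ufl; rewrite -natr1; lra.
  rewrite ler_norml; lra.
have -> : fl u = 0%N by apply/truncn0Pn; rewrite -ltNge.
rewrite harm0.
have lnu : - ln u <= u^-1 - 1 by rewrite -lnV ?posrE // ln_le_sub1.
have [v1|v1] := leP 1 v.
  have := @harm_truncn_bounds 1 v isT v1.
  rewrite harmS harm0 ln1 invr1; have := @ln_le_inv 1 isT; rewrite ln1 invr1.
  have := ln_le0 (ltW u1).
  have : 1 < u^-1 by rewrite invf_gt1.
  rewrite ler_norml; lra.
have -> : fl v = 0%N by apply/truncn0Pn; rewrite -ltNge.
rewrite harm0; have := ln_le u0 uv; have := ln_le0 (ltW v1).
rewrite ler_norml; lra.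
Qed.

Lemma harm_le_ln v : 1 <= v -> harm (fl v) <= 1 + ln v.
Proof.
move=> v1; have /andP[_] := @harm_truncn_bounds 1 v isT v1.
by rewrite harmS harm0 ln1 invr1; lra.
Qed.

End Logarithm.

(** * The reciprocity law *)

Section Reciprocity.
Context {R : realType}.
Implicit Types (x y u v t : R) (n m : nat).
Notation fl := Num.truncn.

Lemma phi1_term_frac y : phi1_term (frac y) = phi1_term y :> (nat -> R).
Proof.
apply/funext => k; rewrite /phi1_term; congr (_ / _).
have -> : k.+1%:R * frac y = k.+1%:R * y + (- (k.+1%:Z * Num.floor y))%:~R.
  by rewrite /frac mulrBr intrN intrM.
by rewrite B1Dz.
Qed.

Lemma phiS_int v : phiS 1 v = 0.
Proof.
rewrite /phiS /series /= big1 // => k _.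
by rewrite /phi1_term mulr1 /B1 rpred_nat mul0r.
Qed.

(** The reciprocity law at [x = 1] is a form of Stirling's formula in which
    the constant is already expressed by [A 1]. *)
Lemma logsum_harm v : 0 < v ->
  `|logsum v + harm (fl v) / 2 - v + A 1 / 2| <= (2 * v)^-1.
Proof.
move=> v0; have := A_reciprocity ltr01 v0; cbv zeta.
rewrite invr1 !mul1r !phiS_int.
have /andP[flv vfl] := truncn_itv (ltW v0).
set n : R := (fl v)%:R; set P := logsum v + _.
(* With [n] the integer part of [v], the elementary terms of the exact formula
   combine to [2 v] up to [(v - n)^2 / v <= 1 / v]. *)
have nv : v + n + n - n * n / v = 2 * v - (v - n) ^+ 2 / v.
  by field; rewrite gt_eqF.
have h : 0 <= (v - n) ^+ 2 / v <= v^-1.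
  rewrite divr_ge0 ?sqr_ge0 ?(ltW v0) //= ler_piMl ?invr_ge0 ?(ltW v0) //.
  rewrite expr_le1 ?subr_ge0 // /n.
  by move: vfl; rewrite -natr1; lra.
have v2 : (2 * v)^-1 = v^-1 / 2 by rewrite invfM mulrC.
rewrite ler_norml v2; move: h; lra.
Qed.

(** In the exact formula the sums occur as
    [x P(v) + P(x v) + (1 - x) (H(v) - H(x v)) / 2] with [P = logsum + H / 2]: the
    instance [x = 1] evaluates [P], and the harmonic sums contribute the logarithm. *)
Lemma phi_reciprocity x v : 0 < x <= 1 -> 0 < v ->
  `|phiS x v + x * phiS x^-1 (x * v) + ln x^-1 / 2 - F x| <= 5 / (x * v).
Proof.
move=> /andP[x0 x1] v0; have xv0 : 0 < x * v by rewrite mulr_gt0.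
have xvv : x * v <= v by rewrite ler_piMl // ltW.
have := A_reciprocity x0 v0; cbv zeta.
have := logsum_harm v0; have := logsum_harm xv0.
have := harm_sub_ln xv0 xvv.
have -> : v / (x * v) = x^-1 by field; rewrite !gt_eqF.
rewrite lnV ?posrE //.
rewrite /F gt_eqF //.
have /andP[flv vfl] := truncn_itv (ltW v0).
have /andP[flxv xvfl] := truncn_itv (ltW xv0).
have {}vfl : v < (fl v)%:R + 1 by rewrite natr1.
have {}xvfl : x * v < (fl (x * v))%:R + 1 by rewrite natr1.
move: flv vfl flxv xvfl; set n : R := (fl v)%:R; set m : R := (fl (x * v))%:R.
move=> flv vfl flxv xvfl.
have nm : x * v + x * n + m - n * m / v = 2 * x * v - (v - n) * (x * v - m) / v.
  by field; rewrite gt_eqF.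
have h : 0 <= (v - n) * (x * v - m) / v <= v^-1.
  have vn : 0 <= v - n <= 1 by lra.
  have xvm : 0 <= x * v - m <= 1 by lra.
  rewrite divr_ge0 ?(ltW v0) ?mulr_ge0 //=; try lra.
  by rewrite ler_piMl ?invr_ge0 ?(ltW v0) // mulr_ile1 //; lra.
have e1 : v^-1 <= (x * v)^-1 by rewrite lef_pV2 ?posrE.
have e2 : (2 * v)^-1 = v^-1 / 2 by rewrite invfM mulrC.
have e3 : (2 * (x * v))^-1 = (x * v)^-1 / 2 by rewrite invfM mulrC.
have ev0 : 0 < v^-1 by rewrite invr_gt0.
rewrite e2 e3 !ler_norml; move: nm h e1.
move: (logsum v) (logsum (x * v)) (harm (fl v)) (harm (fl (x * v))) => L1 L2 H1 H2.
move: (phiS x v) (phiS x^-1 (x * v)) (ln x) (A x) (A 1) ((x * v)^-1) => p1 p2 lx Ax A1 w.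
move: ((v - n) * (x * v - m) / v) v^-1 (n * m / v) ev0 => r z s z0 nm h zw.
set Ho := H1 - H2 - - lx.
set P1 := L1 + H1 / 2 - v + A1 / 2; set P2 := L2 + H2 / 2 - x * v + A1 / 2.
move=> hH hP2 hP1 hA.
have xP1 : - (z / 2) <= x * P1 <= z / 2 by nra.
have xH : - (2 * w) <= (1 - x) * Ho <= 2 * w by nra.
have key : x * (L1 + H2 / 2) + (L2 + H1 / 2) =
   x * P1 + P2 + (1 - x) * Ho / 2 + 2 * x * v - (x + 1) * A1 / 2 - (1 - x) * lx / 2.
  by rewrite /P1 /P2 /Ho; field.
move: key xH xP1 hH hP2 hP1 hA nm; clearbody P1 P2 Ho; lra.
Qed.

End Reciprocity.

(** * Sequences *)

Section EpsilonN.
Context {R : realType}.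
Implicit Types (u : nat -> R) (l : R).

Lemma cvg_epsP u l : u n @[n --> \oo] --> l <->
  forall e : R, 0 < e -> exists n0, forall n, (n0 <= n)%N -> `|u n - l| <= e.
Proof.
split=> [/cvgrPdist_le ul e /ul [n0 _ h]|h].
  by exists n0 => n nn0; rewrite distrC; exact: h.
apply/cvgrPdist_le => e /h [n0 hn0]; exists n0 => // n /= nn0.
by rewrite distrC; exact: hn0.
Qed.

End EpsilonN.

(** * Iteration along the Gauss map *)

Section GaussMap.
Context {R : realType}.
Implicit Types (x y u v t : R) (n m K : nat).
Notation fl := Num.truncn.

Lemma alphaS k x : alpha k.+1 x = frac (alpha k x)^-1.
Proof. by []. Qed.

Lemma alphaSr k x : alpha k.+1 x = alpha k (frac x^-1).
Proof. by rewrite /alpha iterSr. Qed.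

Lemma beta0 x : beta 0 x = 1.
Proof. by rewrite /beta big_ord0. Qed.

Lemma betaS k x : beta k.+1 x = beta k x * alpha k x.
Proof. by rewrite /beta big_ord_recr. Qed.

Lemma normB1_series_le y n : `|series (phi1_term y) n| <= harm n / 2.
Proof.
rewrite /series /harm /= mulr_suml; apply: le_trans (ler_norm_sum _ _ _) _.
apply: ler_sum => k _; rewrite /phi1_term normrM mulrC normfV normr_nat.
by rewrite ler_pM2l ?invr_gt0 // normB1_le.
Qed.

Lemma normphiS_le y u : 1 <= u -> `|phiS y u| <= (1 + ln u) / 2.
Proof.
move=> u1; apply: le_trans (normB1_series_le _ _) _.
by rewrite ler_pM2r ?invr_gt0 // harm_le_ln.
Qed.

(** At the cutoff 1 only the term [n = 1] is left in the exact formula, and the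
    truncated integral is equal to [x]. *)
Lemma A_near0 x : 0 < x < 1 -> x <= A x <= x + 1.
Proof.
move=> /andP[x0 x1]; have := A_reciprocity x0 ltr01; cbv zeta.
have flx : fl x = 0%N by apply/truncn0Pn; rewrite -ltNge.
have l1 : logsum 1 = 0 :> R by rewrite /logsum truncn1 big_nat1 divr1 ln1.
have lx : logsum x = 0 by rewrite /logsum flx big_geq.
have p1 : phiS x 1 = x - 2^-1.
  rewrite /phiS truncn1 /series /= big_nat1 /phi1_term /B1 mul1r -frac_eq0.
  by rewrite frac_id ?x1 ?(ltW x0) // gt_eqF // divr1.
have px : phiS x^-1 x = 0 by rewrite /phiS flx /series /= big_geq.
rewrite mulr1 l1 lx p1 px flx truncn1 harm0 harmS harm0.
by rewrite !invr1; lra.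
Qed.

Lemma normF_le x : 0 < x < 1 -> `|F x| <= `|A 1| + 3.
Proof.
move=> /andP[x0 x1]; rewrite /F gt_eqF //.
have := @A_near0 x; rewrite x0 x1 => /(_ isT) Ax.
have lx0 : ln x <= 0 by rewrite ln_le0 // ltW.
have lx : - ln x <= x^-1 - 1 by rewrite -lnV ?posrE // ln_le_sub1 // invr_gt0.
have xlx : - 1 <= x * ln x <= 0.
  rewrite mulr_ge0_le0 ?(ltW x0) // andbT -lerN2 opprK -mulrN.
  apply: (@le_trans _ _ (x * (x^-1 - 1))); first by rewrite ler_pM2l.
  by rewrite mulrBr divff ?gt_eqF // mulr1 lerBlDr lerDl ltW.
have := ler_norm (A 1 : R); have := ler_norm (- A 1 : R); rewrite normrN.
move: `|A 1| => N h1 h2.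
have : - N <= (x + 1) / 2 * A 1 <= N by nra.
have -> : x / 2 * ln x = (x * ln x) / 2 by field.
rewrite ler_norml; lra.
Qed.

(** The partial sum of the expansion of [phi1] produced by [K] steps of the
    reciprocity law. *)
Definition gauss_sum x K : R :=
  series (G_term x) K - series (fun k => (-1) ^+ k * gamma k x) K / 2.

(** Each step applies the reciprocity law at [alpha j x] with cutoff
    [beta j x * v]; its error is multiplied by [beta j x]. *)
Lemma phi_iterate x K v : 0 < v -> (forall j, (j < K)%N -> 0 < alpha j x <= 1) ->
  `|phiS x v - gauss_sum x K
    - (-1) ^+ K * (beta K x * phiS (alpha K x) (beta K x * v))| <=
  5 / v * \sum_(0 <= j < K) beta j x / beta j.+1 x.
Proof.
move=> v0; elim: K => [|K IHK] h.
  rewrite /gauss_sum /series /= !big_geq // beta0 expr0 !mul1r.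
  by rewrite mul0r !subr0 subrr normr0 mulr0.
have {}IHK := IHK (fun j jK => h j (ltnW jK)).
have b0 : 0 < beta K x.
  by rewrite prodr_gt0 // => i _; have /andP[] := h i (ltnW (ltn_ord i)).
have /andP[a0 a1] := h K (ltnSn K).
have w0 : 0 < beta K x * v by rewrite mulr_gt0.
have := phi_reciprocity (h K (ltnSn K)) w0.
have -> : phiS (alpha K x)^-1 (alpha K x * (beta K x * v)) =
    phiS (alpha K.+1 x) (beta K.+1 x * v).
  by rewrite /phiS alphaS phi1_term_frac betaS mulrCA mulrA.
rewrite big_nat_recr //= mulrDr.
set e := (_ - F _) => he.
rewrite (_ : _ - _ = (phiS x v - gauss_sum x K
    - (-1) ^+ K * (beta K x * phiS (alpha K x) (beta K x * v))) +
    (-1) ^+ K * (beta K x * e)); last first.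
  rewrite /gauss_sum /series /= !big_nat_recr //= /G_term /gamma /e betaS exprS.
  by field.
apply: le_trans (ler_normD _ _) _; apply: lerD => //.
rewrite normrM normrX normrN1 expr1n mul1r normrM (gtr0_norm b0).
apply: le_trans (_ : beta K x * (5 / (alpha K x * (beta K x * v))) <= _).
  by rewrite ler_pM2l.
rewrite betaS le_eqVlt; apply/orP; left; apply/eqP; field.
by rewrite !gt_eqF.
Qed.

End GaussMap.

(** * Convergence at an irrational point *)

Section Irrational.
Context {R : realType}.
Variable x : R.
Hypothesis alpha01 : forall j, 0 < alpha j x < 1.
Implicit Types (u v t : R) (n m K N w : nat).
Notation fl := Num.truncn.
Notation r := (9 / 10 : R).
Notation a k := (alpha k x).
Notation b k := (beta k x).

Lemma beta_gt0 K : 0 < b K.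
Proof. by rewrite prodr_gt0 // => i _; case/andP: (alpha01 i). Qed.

(** With [c] the integer part of [1 / alpha_K], the product is
    [1 - c alpha_K], which is at most [1 - alpha_K]; it is also at most [alpha_K]. *)
Lemma alpha_mul_le K : a K.+1 * a K <= 2^-1.
Proof.
have /andP[a0 a1] := alpha01 K; have /andP[c0 c1] := alpha01 K.+1.
have ai1 : 1 <= (a K)^-1 by rewrite invf_ge1 ?ltW.
have f1 : 1 <= (fl (a K)^-1)%:R :> R.
  by rewrite ler1n truncn_gt0.
have : a K.+1 = (a K)^-1 - (fl (a K)^-1)%:R.
  by rewrite alphaS frac_truncn // invr_ge0 ltW.
move=> aE; have : a K.+1 * a K <= 1 - a K.
  by rewrite aE mulrBl mulVf ?gt_eqF //; nra.
move: c1 a1 c0 a0; nra.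
Qed.

Lemma beta_leS K : b K.+1 <= b K.
Proof.
have /andP[a0 a1] := alpha01 K.
by rewrite betaS ler_piMr ?ltW ?beta_gt0.
Qed.

Lemma beta_le m K : (m <= K)%N -> b K <= b m.
Proof.
move=> /subnK <-; elim: (K - m)%N => [|k IHk] //.
by rewrite addSn; apply: le_trans IHk; exact: beta_leS.
Qed.

Lemma beta_leSS K : b K.+2 <= b K / 2.
Proof.
rewrite !betaS -mulrA ler_pM2l ?beta_gt0 // mulrC.
exact: alpha_mul_le.
Qed.

(** Two steps halve [beta], so any ratio whose square exceeds one half works. *)
Lemma beta_le_geom K : b K <= 2 * r ^+ K.
Proof.
suff : b K <= 2 * r ^+ K /\ b K.+1 <= 2 * r ^+ K.+1 by case.
elim: K => [|K [h1 h2]].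
  have /andP[a0 a1] := alpha01 0.
  rewrite betaS beta0 expr0 expr1; lra.
split => //; apply: le_trans (beta_leSS K) _.
by rewrite !exprS; move: h1; have : 0 <= r ^+ K by [rewrite exprn_ge0|]; lra.
Qed.

Lemma beta_le1 K : b K <= 1.
Proof. by rewrite -(beta0 x) beta_le. Qed.

(** Multiplied by [beta K], the accumulated error satisfies
    [t_(K+1) = alpha_K t_K + beta_K]; two steps halve [t] up to [2 beta_K]. *)
Lemma iterate_error_le K :
  b K * (\sum_(0 <= j < K) b j / b j.+1) <= 20 * r ^+ K.
Proof.
pose t k := b k * (\sum_(0 <= j < k) b j / b j.+1).
have tS k : t k.+1 = a k * t k + b k.
  rewrite /t big_nat_recr //= mulrDr; congr (_ + _).
    by rewrite betaS mulrCA mulrA.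
  by rewrite mulrCA divff ?mulr1 // gt_eqF // beta_gt0.
have t0 k : 0 <= t k.
  rewrite mulr_ge0 ?(ltW (beta_gt0 k)) // sumr_ge0 // => i _.
  by rewrite divr_ge0 ?ltW ?beta_gt0.
suff : t K <= 20 * r ^+ K /\ t K.+1 <= 20 * r ^+ K.+1 by case.
elim: K => [|K [h1 h2]].
  rewrite tS {1 2}/t big_geq // !mulr0 beta0 expr0 expr1; lra.
split => //; rewrite tS [in X in X + _]tS mulrDr mulrA.
have := alpha_mul_le K; have /andP[a0 a1] := alpha01 K.+1.
have := beta_leS K; have := beta_le_geom K; have := beta_gt0 K.
have := t0 K; move: h1; rewrite !exprS.
have : 0 <= r ^+ K by rewrite exprn_ge0.
move: (r ^+ K) (t K) (b K) (b K.+1) (a K.+1 * a K) => rK tK bK bK' aa.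
by move=> rK0 tb tK0 bK0 b1 b2 a_; nra.
Qed.

Lemma beta_small e : 0 < e -> exists K0, forall K, (K0 <= K)%N ->
  r ^+ K <= e /\ b K <= e.
Proof.
move=> e0; have r1 : `|r| < 1 by rewrite ger0_norm; lra.
have /cvg_epsP /(_ (e / 2)) := @cvg_geometric R 1 r r1.
rewrite divr_gt0 // => /(_ isT)[K0 h]; exists K0 => K /h.
rewrite subr0 /geometric /= mul1r ger0_norm ?exprn_ge0 //.
have := beta_le_geom K; split; lra.
Qed.

(** The last index at which the iteration is still meaningful for the cutoff [v]. *)
Lemma stopping_index v : 1 <= v -> exists K, 1 <= b K * v /\ b K.+1 * v < 1.
Proof.
move=> v1; have v0 : 0 < v by apply: lt_le_trans v1.
have [|K0 /(_ K0 (leqnn _)) [_ bK0]] := beta_small (e := (2 * v)^-1).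
  by rewrite invr_gt0 mulr_gt0.
have ex : exists K, b K.+1 * v < 1.
  exists K0; apply: le_lt_trans (_ : b K0 * v < 1).
    by rewrite ler_pM2r // beta_leS.
  rewrite -ltr_pdivlMr // div1r; apply: le_lt_trans bK0 _.
  by rewrite ltf_pV2 ?posrE ?mulr_gt0 //; lra.
have [K hK hmin] := ex_minnP ex; exists K; split => //.
case: K hK hmin => [|K] hK hmin; first by rewrite beta0 mul1r.
by rewrite leNgt; apply/negP => /hmin; rewrite ltnn.
Qed.

(** [f N] is approximated by the partial sums of the continued-fraction
    expansion at every scale [s N] up to an error which is negligible except
    for a logarithm that [gamma] controls. *)
Definition tracks (f : nat -> R) (s : nat -> nat) :=
  exists C, forall e, 0 < e -> exists w0, forall N K, (w0 <= s N)%N ->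
    1 <= b K * (s N)%:R ->
    `|f N - gauss_sum x K| <= e + C * (r ^+ K + b K + b K * ln (b K * (s N)%:R)).

Lemma phi1_tracks : tracks (series (phi1_term x)) id.
Proof.
(* 100 is the constant 5 of [phi_iterate] times the constant 20 of
   [iterate_error_le]. *)
exists 100 => e e0; exists 1%N => N K N1 bN.
have N0 : 0 < N%:R :> R by rewrite ltr0n.
have aj j : (j < K)%N -> 0 < alpha j x <= 1.
  by move=> _; have /andP[-> /ltW] := alpha01 j.
have := phi_iterate N0 aj.
have -> : phiS x N%:R = series (phi1_term x) N by rewrite /phiS natrK.
have h1 := normphiS_le (a K) bN.
have h2 : 5 / N%:R * (\sum_(0 <= j < K) b j / b j.+1) <= 100 * r ^+ K.
  apply: le_trans (_ : 5 * (b K * (\sum_(0 <= j < K) b j / b j.+1)) <= _).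
    rewrite -mulrA ler_pM2l // ler_wpM2r //.
      by rewrite sumr_ge0 // => i _; rewrite divr_ge0 ?ltW ?beta_gt0.
    by rewrite -div1r ler_pdivrMr.
  have := iterate_error_le K; lra.
set E := (_ - (_ * _)) => hE.
have -> : series (phi1_term x) N - gauss_sum x K =
   E + (-1) ^+ K * (b K * phiS (a K) (b K * N%:R)) by rewrite /E; ring.
apply: le_trans (ler_normD _ _) _.
rewrite normrM normrX normrN1 expr1n mul1r normrM (gtr0_norm (beta_gt0 K)).
have : b K * `|phiS (a K) (b K * N%:R)| <= b K * ((1 + ln (b K * N%:R)) / 2).
  by rewrite ler_pM2l ?beta_gt0.
have : 0 <= b K * ln (b K * N%:R) by rewrite mulr_ge0 ?ln_ge0 ?(ltW (beta_gt0 K)).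
have := beta_gt0 K; move: hE h2 e0; rewrite mulrA mulrDr mulr1; lra.
Qed.

Lemma G_series_cvg : cvgn (series (G_term x)).
Proof.
apply: normed_cvg.
have r1 : `|r| < 1 by rewrite ger0_norm; lra.
apply: (series_le_cvg (v_ := geometric (2 * (`|A 1| + 3)) r)) => [n|n|n|].
- exact: normr_ge0.
- by rewrite /geometric /= mulr_ge0 ?exprn_ge0 // mulr_ge0 // addr_ge0.
- rewrite /geometric /= /G_term normrM normrM normrX normrN1 expr1n mul1r.
  rewrite (gtr0_norm (beta_gt0 n)) [leRHS]mulrAC.
  by rewrite ler_pM ?normr_ge0 ?(ltW (beta_gt0 n)) ?beta_le_geom ?normF_le.
- exact: is_cvg_geometric_series.
Qed.

Let gseries := series (fun k => (-1) ^+ k * gamma k x).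

Lemma gauss_sum_cvg : cvgn gseries ->
  gauss_sum x K @[K --> \oo] --> limn (series (G_term x)) - limn gseries / 2.
Proof.
by move=> cg; apply: cvgB; [exact: G_series_cvg|apply: cvgMr_tmp].
Qed.

(** At the stopping index [b K * s N] is less than [1 / alpha K], so the
    logarithmic error is at most [gamma K x], which tends to 0 together with the
    general term of the convergent series. *)
Lemma tracks_cvg f s : tracks f s ->
  (forall w0, exists N0, forall N, (N0 <= N)%N -> (w0 <= s N)%N) ->
  cvgn gseries -> f N @[N --> \oo] --> limn (series (G_term x)) - limn gseries / 2.
Proof.
move=> [C hC] soo cg; set L := _ - _.
have gamma0 : forall e, 0 < e -> exists K0, forall K, (K0 <= K)%N -> gamma K x <= e.
  move=> e e0; have /cvg_epsP /(_ e e0) [K0 h] := cvg_series_cvg_0 cg.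
  exists K0 => K /h; rewrite subr0 normrM normrX normrN1 expr1n mul1r.
  exact: le_trans (ler_norm _).
apply/cvg_epsP => e e0.
have e4 : 0 < e / 4 by lra.
have [w0 hw0] := hC _ e4.
have C1 : 0 < `|C| + 1 by have := normr_ge0 C; lra.
pose d := e / 12 / (`|C| + 1).
have d0 : 0 < d by rewrite !divr_gt0.
have [K1 hK1] := beta_small d0; have [K2 hK2] := gamma0 _ d0.
have /cvg_epsP /(_ _ e4) [K3 hK3] := gauss_sum_cvg cg.
pose K0 := maxn K1 (maxn K2 K3).
have [N0 hN0] := soo (maxn (maxn w0 1) (fl (b K0)^-1).+1).
exists N0 => N /hN0; rewrite !geq_max -andbA => /and3P[ww0 w1 wK0].
have s1 : 1 <= (s N)%:R :> R by rewrite ler1n.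
have [K [bK bSK]] := stopping_index s1.
have KK0 : (K0 <= K)%N.
  rewrite leqNgt; apply/negP => KltK0; move: bSK; apply/negP; rewrite -leNgt.
  apply: le_trans (_ : b K0 * (s N)%:R <= _); last first.
    by rewrite ler_pM2r ?beta_le // (lt_le_trans ltr01).
  rewrite mulrC -ler_pdivrMr ?beta_gt0 // div1r.
  apply: le_trans (_ : (fl (b K0)^-1).+1%:R <= _); last by rewrite ler_nat.
  exact/ltW/truncnS_gt.
move: (KK0); rewrite !geq_max => /and3P[/hK1 [rK bd] /hK2 gd /hK3 SL].
have := hw0 N K ww0 bK => fS.
have lng : b K * ln (b K * (s N)%:R) <= d.
  apply: le_trans gd; rewrite /gamma ler_pM2l ?beta_gt0 //.
  have aK0 : 0 < a K by case/andP: (alpha01 K).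
  apply: ln_le; first exact: lt_le_trans bK.
  rewrite -[(_)^-1]mul1r ler_pdivlMr // mulrAC -betaS; exact: ltW.
have lng0 : 0 <= b K * ln (b K * (s N)%:R) by rewrite mulr_ge0 ?ln_ge0 ?(ltW (beta_gt0 K)).
have sum_le : r ^+ K + b K + b K * ln (b K * (s N)%:R) <= 3 * d by lra.
have sum_ge : 0 <= r ^+ K + b K + b K * ln (b K * (s N)%:R).
  by rewrite !addr_ge0 ?exprn_ge0 // ltW // beta_gt0.
have Cs : C * (r ^+ K + b K + b K * ln (b K * (s N)%:R)) <= e / 4.
  apply: le_trans (_ : (`|C| + 1) * (3 * d) <= _).
    apply: le_trans (ler_wpM2r sum_ge (_ : C <= `|C| + 1)) _.
      by have := ler_norm C; lra.
    by rewrite ler_pM2l.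
  by rewrite le_eqVlt; apply/orP; left; apply/eqP; rewrite /d; field; rewrite gt_eqF.
have -> : f N - L = (f N - gauss_sum x K) + (gauss_sum x K - L) by ring.
apply: le_trans (ler_normD _ _) _.
lra.
Qed.

(** At a scale between [1 / b K] and [2 / b K] the logarithm is bounded by 1, so
    [f] there is asymptotic to the [K]-th partial sum. *)
Lemma tracks_cvg_gamma f s : tracks f s ->
  (forall w, exists2 N, (w <= N)%N & s N = w) ->
  cvgn f -> cvgn gseries.
Proof.
move=> [C hC] ssurj /cvg_ex [l fl].
suff Sl : gauss_sum x K @[K --> \oo] --> l.
  have -> : gseries = (fun K => 2 * (series (G_term x) K - gauss_sum x K)).
    by apply/funext => K; rewrite /gauss_sum -/gseries; field.
  by apply: is_cvgMl_tmp; apply: is_cvgB; [exact: G_series_cvg|apply/cvg_ex; exists l].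
apply/cvg_epsP => e e0.
have e4 : 0 < e / 4 by lra.
have /cvg_epsP /(_ _ e4) [N0 hN0] := fl.
have [w0 hw0] := hC _ e4.
have C1 : 0 < `|C| + 1 by have := normr_ge0 C; lra.
pose d := e / 12 / (`|C| + 1).
have d0 : 0 < d by rewrite !divr_gt0.
have [K1 hK1] := beta_small d0.
have [|K2 hK2] := beta_small (e := (maxn w0 N0).+1%:R^-1).
  by rewrite invr_gt0.
exists (maxn K1 K2) => K; rewrite geq_max => /andP[/hK1 [rK bd] /hK2 [_ bw]].
have b0 := beta_gt0 K.
(* The least integer [w] with [b K * w > 1], hence [b K * w <= 2]. *)
pose w := (Num.truncn (b K)^-1).+1.
have wb : 1 <= b K * w%:R.
  by rewrite mulrC -ler_pdivrMr // div1r; exact/ltW/truncnS_gt.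
have bw2 : b K * w%:R <= 2.
  rewrite /w -natr1 mulrDr mulr1.
  have : b K * (Num.truncn (b K)^-1)%:R <= 1.
    rewrite mulrC -ler_pdivlMr // div1r truncn_le invr_ge0; exact: ltW.
  have := beta_le1 K; lra.
have [N wN sN] := ssurj w.
have ww : (maxn w0 N0 <= w)%N.
  apply: leq_trans (leqnSn _) _; rewrite -(ler_nat R).
  apply: le_trans (_ : (b K)^-1 <= _); last exact/ltW/truncnS_gt.
  by rewrite -[leLHS]invrK lef_pV2 ?posrE ?invr_gt0.
move: ww; rewrite geq_max => /andP[ww0 wN0].
have := hw0 N K; rewrite sN => /(_ ww0 wb) fS.
have fNl := hN0 N (leq_trans wN0 wN).
have lng : b K * ln (b K * w%:R) <= b K.
  rewrite ler_piMr ?(ltW b0) //.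
  by have := @ln_le_sub1 _ (b K * w%:R) (lt_le_trans ltr01 wb); lra.
have lng0 : 0 <= b K * ln (b K * w%:R) by rewrite mulr_ge0 ?ln_ge0 ?(ltW b0).
have sum_le : r ^+ K + b K + b K * ln (b K * w%:R) <= 3 * d by lra.
have sum_ge : 0 <= r ^+ K + b K + b K * ln (b K * w%:R).
  by rewrite !addr_ge0 ?exprn_ge0 // ltW.
have Cs : C * (r ^+ K + b K + b K * ln (b K * w%:R)) <= e / 4.
  apply: le_trans (_ : (`|C| + 1) * (3 * d) <= _).
    apply: le_trans (ler_wpM2r sum_ge (_ : C <= `|C| + 1)) _.
      by have := ler_norm C; lra.
    by rewrite ler_pM2l.
  by rewrite le_eqVlt; apply/orP; left; apply/eqP; rewrite /d; field; rewrite gt_eqF.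
have -> : gauss_sum x K - l = (f N - l) - (f N - gauss_sum x K) by ring.
apply: le_trans (ler_normB _ _) _.
lra.
Qed.

End Irrational.

(** * The Dirichlet kernel *)

Section DirichletKernel.
Context {R : realType}.
Implicit Types (s t c : R) (n k N : nat).

Lemma derive_le0_nonincr (f df : R -> R) (a b : R) : a <= b ->
  (forall t, a <= t <= b -> is_derive t 1 f (df t)) ->
  (forall t, a <= t <= b -> df t <= 0) -> f b <= f a.
Proof.
rewrite le_eqVlt => /orP[/eqP ->//|ab] d df0.
have [||c /andP[ac cb] E] := @MVT _ f df a b ab.
- by move=> t; rewrite in_itv /= => /andP[/ltW at_ /ltW tb]; apply: d; rewrite at_.
- apply: derivable_within_continuous => t; rewrite in_itv /= => tab.
  by have [] := d t tab.
rewrite -subr_le0 E mulr_le0_ge0 ?subr_ge0 ?(ltW ab) //.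
by apply: df0; rewrite !ltW.
Qed.

Lemma derive_ge0_nondecr (f df : R -> R) (a b : R) : a <= b ->
  (forall t, a <= t <= b -> is_derive t 1 f (df t)) ->
  (forall t, a <= t <= b -> 0 <= df t) -> f a <= f b.
Proof.
move=> ab d df0; rewrite -lerN2.
apply: (derive_le0_nonincr (f := fun t => - f t) (df := fun t => - df t) ab).
  by move=> t /d dt; exact: is_deriveN.
by move=> t /df0; rewrite oppr_le0.
Qed.

Lemma is_derive_mull c t : is_derive t 1 (fun s : R => c * s) c.
Proof.
have : is_derive t 1 (c \*: (@id R)) (c *: 1) by exact: is_deriveZ.
by rewrite /GRing.scale /= mulr1.
Qed.

Lemma is_derive_sin_mul c t : is_derive t 1 (fun s => sin (c * s)) (cos (c * t) * c).
Proof.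
apply: (@is_derive1_comp _ sin (fun s => c * s)).
exact: is_derive_mull.
Qed.

Lemma is_derive_cos_mul c t : is_derive t 1 (fun s => cos (c * s)) (- sin (c * t) * c).
Proof.
apply: (@is_derive1_comp _ cos (fun s => c * s)).
exact: is_derive_mull.
Qed.

Lemma sin_le_id s : 0 <= s -> sin s <= s.
Proof.
move=> s0; have := @derive_ge0_nondecr (fun t => t - sin t) (fun t => 1 - cos t) _ _ s0.
rewrite sin0 !subr0 subr_ge0; apply.
by move=> t _; rewrite subr_ge0 cos_le1.
Qed.

Lemma norm_sin_le s : 0 <= s -> `|sin s| <= s.
Proof.
move=> s0; rewrite ler_norml sin_le_id // andbT lerNl.
have := @derive_ge0_nondecr (fun t => t + sin t) (fun t => 1 + cos t) _ _ s0.
rewrite sin0 addr0 -[0 <= _]/(0 <= s + sin s) => h.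
rewrite -subr_ge0 opprK; apply: h.
by move=> t _; rewrite addrC -[1]opprK subr_ge0 cos_geN1.
Qed.

(** By monotonicity while the cosine is at least one half; beyond, the sine is at
    least one half. *)
Lemma sin_ge_linear s : 0 <= s <= pi / 2 -> s / pi <= sin s.
Proof.
move=> /andP[s0 s1]; have pi2 := pi_ge2 R; have pi0 := pi_gt0 R.
have spi : s <= pi by lra.
have sin_ge0 : 0 <= sin s by rewrite sin_ge0_pi ?s0.
have [c1|c1] := leP 2^-1 (cos s).
  apply: (@le_trans _ _ (s / 2)).
    by rewrite ler_wpM2l // lef_pV2 ?posrE.
  have := @derive_ge0_nondecr (fun t => sin t - 2^-1 * t) (fun t => cos t - 2^-1) _ _ s0.
  rewrite sin0 mulr0 subrr subr_ge0 mulrC; apply.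
    by move=> t _; apply: is_deriveB; exact: is_derive_mull.
  move=> t /andP[t0 ts]; rewrite subr_ge0; apply: le_trans c1 _.
  rewrite leNgt ltr_cos ?in_itv /= ?s0 ?t0 ?spi ?(le_trans ts) //.
  by rewrite -leNgt.
have c0 : 0 <= cos s by rewrite cos_ge0_pihalf // s1 andbT; lra.
have := cos2Dsin2 s => E.
apply: (@le_trans _ _ 2^-1); first by rewrite ler_pdivrMr //; lra.
nra.
Qed.

Definition sin_sum N s : R := \sum_(0 <= k < N) sin (2 * k.+1%:R * s) / k.+1%:R.

Definition cos_sum N s : R := \sum_(0 <= k < N) 2 * cos (2 * k.+1%:R * s).

Lemma is_derive_sin_sum N s : is_derive s 1 (sin_sum N) (cos_sum N s).
Proof.
elim: N => [|N IHN].
  rewrite (_ : sin_sum 0 = cst 0); last by apply/funext => t; rewrite /sin_sum big_geq.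
  by rewrite /cos_sum big_geq //; exact: is_derive_cst.
rewrite (_ : sin_sum N.+1 =
    fun t => sin_sum N t + N.+1%:R^-1 * sin (2 * N.+1%:R * t)); last first.
  by apply/funext => t; rewrite /sin_sum big_nat_recr //= [_ / N.+1%:R]mulrC.
rewrite /cos_sum big_nat_recr //=; apply: is_deriveD.
have -> : 2 * cos (2 * N.+1%:R * s) =
    N.+1%:R^-1 *: (cos (2 * N.+1%:R * s) * (2 * N.+1%:R)).
  have : N.+1%:R != 0 :> R by rewrite pnatr_eq0.
  by rewrite /GRing.scale /=; move: N.+1%:R => c c0; field.
apply: is_deriveZ; exact: is_derive_sin_mul.
Qed.

Lemma dirichlet_kernel N s :
  sin s * (cos_sum N s + 1) = sin ((2 * N%:R + 1) * s).
Proof.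
elim: N => [|N IHN]; first by rewrite /cos_sum big_geq // mulr0 !add0r mulr1 mul1r.
rewrite /cos_sum big_nat_recr //= -/(cos_sum N s).
rewrite addrAC mulrDr IHN.
have -> : (2 * N%:R + 1) * s = 2 * N.+1%:R * s - s by rewrite -natr1; ring.
have -> : (2 * N.+1%:R + 1) * s = 2 * N.+1%:R * s + s by ring.
by rewrite sinB sinD; ring.
Qed.

Let M N : R := 2 * N%:R + 1.

(** The factor multiplying the cosine is what integration by parts of the
    Dirichlet kernel produces. The two choices [e = 1] and [e = -1] make the
    derivative of constant sign on ]0, pi / 2], which replaces the estimate of the
    remaining integral. *)
Lemma is_derive_kernel_remainder N e s : 0 < sin s ->
  is_derive s 1 (fun t => sin_sum N t + t + (cos (M N * t) + e) * (M N * sin t)^-1)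
    (- (cos (M N * s) + e) * cos s / (M N * sin s ^+ 2)).
Proof.
move=> s0; have M0 : 0 < M N by rewrite /M; have := ler0n R N; lra.
have D1 : is_derive s 1 (fun t => sin_sum N t + t) (cos_sum N s + 1).
  by apply: is_deriveD; exact: is_derive_sin_sum.
have D2 : is_derive s 1 (fun t => cos (M N * t) + e) (- sin (M N * s) * M N + 0).
  by apply: is_deriveD; exact: is_derive_cos_mul.
have D3 : is_derive s 1 (fun t => (M N * sin t)^-1)
    (- (M N * sin s) ^- 2 *: (M N *: cos s)).
  by apply: is_deriveV; rewrite mulf_neq0 ?gt_eqF.
have D : is_derive s 1
    (fun t => sin_sum N t + t + (cos (M N * t) + e) * (M N * sin t)^-1)
    (cos_sum N s + 1 +
     ((cos (M N * s) + e) *: (- (M N * sin s) ^- 2 *: (M N *: cos s)) +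
      (M N * sin s)^-1 *: (- sin (M N * s) * M N + 0))).
  exact: is_deriveD D1 (is_deriveM D2 D3).
apply: (is_derive_eq D).
rewrite /GRing.scale /=.
have := dirichlet_kernel N s; rewrite -/(M N) => <-.
by field; rewrite !gt_eqF.
Qed.

Lemma sin_sum_pihalf N : sin_sum N (pi / 2) = 0.
Proof.
rewrite /sin_sum big1 // => k _.
have -> : 2 * k.+1%:R * (pi / 2) = 0 + pi *+ k.+1 :> R.
  by rewrite add0r -mulr_natr; field.
by rewrite (alternatingn (@sinDpi R)) sin0 mulr0 mul0r.
Qed.

Lemma cos_odd_pihalf N : cos (M N * (pi / 2)) = 0.
Proof.
have -> : M N * (pi / 2) = pi / 2 + pi *+ N :> R.
  by rewrite /M -mulr_natr; field.
by rewrite (alternatingn (@cosDpi R)) cos_pihalf mulr0.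
Qed.

(** The monotone functions of [is_derive_kernel_remainder] are compared at [s] and
    at [pi / 2], where the sum of sines vanishes. *)
Lemma sin_sum_approx N s : 0 < s <= pi / 2 ->
  `|sin_sum N s + s - pi / 2| <= 2 / (M N * sin s).
Proof.
move=> /andP[s0 s1]; have pi0 := pi_gt0 R.
have M0 : 0 < M N by rewrite /M; have := ler0n R N; lra.
have sin0 t : s <= t <= pi / 2 -> 0 < sin t.
  by move=> /andP[st tp]; rewrite sin_gt0_pi //; lra.
have cos0 t : s <= t <= pi / 2 -> 0 <= cos t.
  by move=> /andP[st tp]; rewrite cos_ge0_pihalf //; lra.
have sins : 0 < sin s by rewrite sin0 ?lexx.
pose p e t := sin_sum N t + t + (cos (M N * t) + e) * (M N * sin t)^-1.
have p2 e : p e (pi / 2) = pi / 2 + e / M N.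
  by rewrite /p sin_sum_pihalf cos_odd_pihalf sin_pihalf !add0r mulr1.
have c1 t : cos (M N * t) <= 1 by exact: cos_le1.
have c2 t : - 1 <= cos (M N * t) by exact: cos_geN1.
have H1 : p 1 (pi / 2) <= p 1 s.
  apply: (derive_le0_nonincr s1 (fun t ts => is_derive_kernel_remainder N 1 (sin0 t ts))).
  move=> u us; have Mu : 0 <= (M N * sin u ^+ 2)^-1.
    by rewrite invr_ge0 mulr_ge0 ?sqr_ge0 // ltW.
  apply: mulr_le0_ge0 => //; apply: mulr_le0_ge0; last exact: cos0.
  by have := c2 u; lra.
have H2 : p (- 1) s <= p (- 1) (pi / 2).
  apply: (derive_ge0_nondecr s1 (fun t ts => is_derive_kernel_remainder N (- 1) (sin0 t ts))).
  move=> u us; have Mu : 0 <= (M N * sin u ^+ 2)^-1.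
    by rewrite invr_ge0 mulr_ge0 ?sqr_ge0 // ltW.
  apply: mulr_ge0 => //; apply: mulr_ge0; last exact: cos0.
  by have := c1 u; lra.
move: H1 H2; rewrite !p2 /p.
have Mi : 0 < (M N)^-1 by rewrite invr_gt0.
have := c1 s; have := c2 s.
have : 0 < (M N * sin s)^-1 by rewrite invr_gt0 mulr_gt0.
move: (_^-1) => z z0 hc2 hc1 H1 H2.
rewrite ler_norml; nra.
Qed.

End DirichletKernel.

(** * The Fourier series of the sawtooth *)

Section Sawtooth.
Context {R : realType}.
Implicit Types (t : R) (n k N : nat).

(** The order of magnitude of the error of the [N]-th partial sum of the Fourier
    series of [B1] at distance [t] from an integer. At [t = 0] it is 0, in
    accordance with the vanishing of that error at integers. *)
Definition trunc_inv N t : R := Num.min 1 (N%:R * t)^-1.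

Definition sawtooth_sum N t : R :=
  - pi^-1 * \sum_(0 <= k < N) sin (2 * pi * k.+1%:R * t) / k.+1%:R.

Lemma sawtooth_sumE N t : sawtooth_sum N t = - pi^-1 * sin_sum N (pi * t).
Proof.
rewrite /sawtooth_sum /sin_sum; congr (_ * _); apply: eq_bigr => k _.
by congr (sin _ / _); ring.
Qed.

(** The Dirichlet kernel gives the bound [1 / (N t)]; for [N t < 1] each sine is
    replaced by its argument. *)
Lemma sawtooth_err_half N t : (0 < N)%N -> 0 < t <= 2^-1 ->
  `|sawtooth_sum N t - (t - 2^-1)| <= 3 * trunc_inv N t.
Proof.
move=> N0 /andP[t0 t1]; have pi0 := pi_gt0 R; have pi2 := pi_ge2 R.
have N1 : 1 <= N%:R :> R by rewrite ler1n.
have Nt0 : 0 < N%:R * t by rewrite mulr_gt0 // (lt_le_trans ltr01).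
have pt : 0 < pi * t <= pi / 2 by rewrite mulr_gt0 //= ler_pM2l.
have -> : sawtooth_sum N t - (t - 2^-1) =
    - pi^-1 * (sin_sum N (pi * t) + pi * t - pi / 2).
  rewrite sawtooth_sumE; move: (sin_sum _ _) => S.
  have : (pi : R) != 0 by rewrite gt_eqF.
  by move: (pi : R) => p p0; field.
rewrite normrM normrN [`|pi^-1|]gtr0_norm ?invr_gt0 //.
have pV : pi^-1 <= 2^-1 :> R by rewrite lef_pV2 ?posrE.
have pV0 : 0 < pi^-1 :> R by rewrite invr_gt0.
have B : pi^-1 * `|sin_sum N (pi * t) + pi * t - pi / 2| <= (N%:R * t)^-1.
  have := sin_sum_approx N pt.
  have : t <= sin (pi * t).
    have := @sin_ge_linear _ (pi * t); rewrite (ltW (andP pt).1) (andP pt).2.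
    by rewrite mulrAC divff ?gt_eqF // mul1r; exact.
  move=> tsin h.
  apply: (@le_trans _ _ (2^-1 * (2 / ((2 * N%:R + 1) * sin (pi * t))))).
    by rewrite ler_pM ?(ltW pV0).
  rewrite mulrA mulVf // mul1r lef_pV2 ?posrE //; last first.
    by rewrite mulr_gt0 ?(lt_le_trans t0) //; lra.
  by rewrite ler_pM ?(ltW t0) //; lra.
rewrite /trunc_inv; case: (leP 1 (N%:R * t)^-1) => h; last first.
  by apply: le_trans B _; rewrite ler_peMl ?invr_ge0 ?(ltW Nt0) //; lra.
have Nt1 : N%:R * t <= 1 by rewrite -invf_ge1.
rewrite mulr1; apply: le_trans (_ : pi^-1 * (2 * N%:R * pi * t + pi * t + pi / 2) <= _).
  rewrite ler_pM2l //; apply: le_trans (ler_normB _ _) _.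
  rewrite [`|pi / 2|]gtr0_norm ?divr_gt0 // lerD2r.
  apply: le_trans (ler_normD _ _) _.
  rewrite [`|pi * t|]gtr0_norm ?(andP pt).1 // lerD2r.
  apply: le_trans (ler_norm_sum _ _ _) _.
  apply: le_trans (_ : \sum_(0 <= k < N) 2 * pi * t <= _); last first.
    by rewrite sumr_const_nat subn0 -mulr_natr le_eqVlt; apply/orP; left; apply/eqP; ring.
  apply: ler_sum => k _; rewrite normrM normfV normr_nat ler_pdivrMr ?ltr0n //.
  have k0 : 0 <= 2 * k.+1%:R * (pi * t) by rewrite !mulr_ge0 ?(ltW pi0) ?(ltW t0).
  have -> : 2 * pi * t * k.+1%:R = 2 * k.+1%:R * (pi * t) by ring.
  exact: norm_sin_le.
apply: le_trans (_ : pi^-1 * (pi * (2 * (N%:R * t) + t + 2^-1)) <= _).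
  by rewrite ler_pM2l // le_eqVlt; apply/orP; left; apply/eqP; ring.
by rewrite mulKf ?gt_eqF //; lra.
Qed.

Lemma sawtooth_sum1B N t : sawtooth_sum N (1 - t) = - sawtooth_sum N t.
Proof.
rewrite /sawtooth_sum -mulrN -sumrN; congr (_ * _); apply: eq_bigr => k _.
rewrite -mulNr; congr (_ / _).
have -> : 2 * pi * k.+1%:R * (1 - t) = - (2 * pi * k.+1%:R * t) + pi *+ 2 *+ k.+1.
  by rewrite -[_ *+ k.+1]mulr_natr -[pi *+ 2]mulr_natr; ring.
by rewrite (periodicn (@sinD2pi R)) sinN.
Qed.

Lemma sin_2piDz t (m : int) : sin (2 * pi * (t + m%:~R)) = sin (2 * pi * t).
Proof.
have H (u : R) (n : nat) : sin (2 * pi * (u + n%:R)) = sin (2 * pi * u).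
  have -> : 2 * pi * (u + n%:R) = 2 * pi * u + pi *+ 2 *+ n.
    by rewrite -[_ *+ n]mulr_natr -[pi *+ 2]mulr_natr; ring.
  by rewrite (periodicn (@sinD2pi R)).
case: m => m; first exact: H.
by rewrite -(H (t + (Negz m)%:~R) m.+1) NegzE intrN addrNK.
Qed.

Lemma sawtooth_sumDz N t (m : int) : sawtooth_sum N (t + m%:~R) = sawtooth_sum N t.
Proof.
rewrite /sawtooth_sum; congr (_ * _); apply: eq_bigr => k _; congr (_ / _).
have kE : (k.+1%:Z * m)%:~R = k.+1%:R * m%:~R :> R by rewrite intrM.
transitivity (sin (2 * pi * (k.+1%:R * t + (k.+1%:Z * m)%:~R))).
  by congr sin; rewrite kE; ring.
by rewrite sin_2piDz; congr sin; ring.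
Qed.

Lemma trunc_inv_ge0 N t : 0 <= t -> 0 <= trunc_inv N t.
Proof. by move=> t0; rewrite le_min ler01 invr_ge0 mulr_ge0. Qed.

(** The points beyond 1 / 2 reduce to the others by oddness. Adding the
    contributions of the two one-sided distances to the integers avoids taking
    their minimum. *)
Lemma sawtooth_err N t : (0 < N)%N -> t \isn't a Num.int ->
  `|sawtooth_sum N t - B1 t| <=
  3 * (trunc_inv N (frac t) + trunc_inv N (frac (- t))).
Proof.
move=> N0 tint; rewrite /B1 (negbTE tint).
have f0 : 0 < frac t by rewrite lt_neqAle frac_ge0 eq_sym frac_eq0 tint.
have f1 := frac_lt1 t.
have fN : frac (- t) = 1 - frac t.
  have -> : - t = (1 - frac t) + (- (1 + Num.floor t))%:~R.
    by rewrite intrN intrD /frac; ring.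
  by rewrite fracDz frac_id //; lra.
have sf : sawtooth_sum N t = sawtooth_sum N (frac t).
  by rewrite -(sawtooth_sumDz N (frac t) (Num.floor t)) /frac subrK.
rewrite fN sf; move: f0 f1; move: (frac t) => u u0 u1.
have [uh|uh] := leP u 2^-1.
  apply: le_trans (sawtooth_err_half N0 _) _; first by rewrite u0.
  by rewrite ler_pM2l // lerDl trunc_inv_ge0 //; lra.
have -> : sawtooth_sum N u - (u - 2^-1) =
    - (sawtooth_sum N (1 - u) - (1 - u - 2^-1)).
  by rewrite sawtooth_sum1B; field.
rewrite normrN; apply: le_trans (sawtooth_err_half N0 _) _; first by lra.
by rewrite ler_pM2l // lerDr trunc_inv_ge0 //; lra.
Qed.

Lemma sawtooth_int N t : t \is a Num.int -> sawtooth_sum N t = 0.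
Proof.
move=> /intrP[m ->]; rewrite -[_%:~R]add0r sawtooth_sumDz /sawtooth_sum.
by rewrite big1 ?mulr0 // => k _; rewrite mulr0 sin0 mul0r.
Qed.

End Sawtooth.

(** * The divisor series *)

Section Hyperbola.
Context {R : realType}.
Implicit Types (f : nat -> R) (n k N w : nat).

Lemma tau_sum n N : (0 < n <= N)%N ->
  (tau n)%:R = \sum_(0 <= i < N) (i.+1 %| n)%N%:R :> R.
Proof.
move=> /andP[n0 nN].
have -> : tau n = count (fun d => d %| n)%N (index_iota 1 N.+1).
  rewrite -size_filter /tau; apply: perm_size; apply: uniq_perm.
  - exact: divisors_uniq.
  - by rewrite filter_uniq // iota_uniq.
  move=> d; rewrite -dvdn_divisors // mem_filter mem_index_iota.
  case: (boolP (d %| n)%N) => //= dn.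
  by rewrite (dvdn_gt0 n0 dn) ltnS (leq_trans (dvdn_leq n0 dn)).
rewrite -sum1_count natr_sum big_add1 /= big_mkcond /=.
by apply: eq_bigr => i _; case: (_ %| _)%N.
Qed.

(** The multiples of [d] up to [N], listed by their quotients. *)
Lemma sum_pairs_dvdn f N d : (0 < d)%N ->
  \sum_(0 <= k < N) (d %| k.+1)%N%:R * f k.+1 =
  \sum_(0 <= j < N %/ d) f (d * j.+1)%N.
Proof.
move=> d0.
transitivity (\sum_(0 <= k < N) \sum_(0 <= j < N %/ d)
    (if (d * j.+1 == k.+1)%N then f k.+1 else 0)).
  apply: eq_big_nat => k /andP[_ kN].
  have [/dvdnP[m km]|ndk] := boolP (d %| k.+1)%N; last first.
    rewrite mul0r big1 // => j _; case: eqP => // djk.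
    by rewrite -djk dvdn_mulr in ndk.
  case: m km => [|m] km; first by rewrite mul0n in km.
  rewrite mul1r -big_mkcond /=.
  under eq_bigl do rewrite km mulnC eqn_pmul2r // eqSS.
  rewrite (big_nat1_eq _ (fun=> f k.+1)) /= leq_divRL // -km.
  by rewrite kN.
rewrite exchange_big_nat; apply: eq_big_nat => j /andP[_ jN].
rewrite -big_mkcond /=.
have dj : (0 < d * j.+1)%N by rewrite muln_gt0 d0.
rewrite (eq_bigl (fun k => k == (d * j.+1).-1)); last first.
  by move=> k; rewrite -[in LHS](prednK dj) eqSS eq_sym.
rewrite (big_nat1_eq _ (fun k => f k.+1)) /= prednK //.
by rewrite mulnC -leq_divRL // jN.
Qed.

(** Dirichlet's hyperbola method. *)
Lemma hyperbola f N w : (w ^ 2 <= N < w.+1 ^ 2)%N ->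
  \sum_(0 <= k < N) (tau k.+1)%:R * f k.+1 =
  2 * (\sum_(0 <= i < w) \sum_(0 <= j < N %/ i.+1) f (i.+1 * j.+1)%N) -
  \sum_(0 <= i < w) \sum_(0 <= j < w) f (i.+1 * j.+1)%N.
Proof.
move=> /andP[wN Nw].
have wN' : (w <= N)%N.
  by apply: leq_trans wN; case: (w) => // m; rewrite expnS leq_pmulr // expn_gt0.
pose g i j := if (i.+1 * j.+1 <= N)%N then f (i.+1 * j.+1)%N else 0.
have inner i : \sum_(0 <= j < N %/ i.+1) f (i.+1 * j.+1)%N = \sum_(0 <= j < N) g i j.
  have NiN : (N %/ i.+1 <= N)%N by rewrite leq_div.
  rewrite [RHS](big_cat_nat _ NiN) //= [X in _ + X]big_nat_cond.
  rewrite [X in _ + X]big1 ?addr0; last first.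
    move=> j /andP[/andP[Nj _] _]; rewrite /g mulnC -leq_divRL //.
    by rewrite leqNgt ltnS Nj.
  apply: eq_big_nat => j /andP[_ jN].
  by rewrite /g mulnC -leq_divRL // jN mulnC.
have gC i j : g i j = g j i by rewrite /g mulnC.
rewrite (@eq_big_nat _ _ _ 0 N _ (fun k => \sum_(0 <= i < N) (i.+1 %| k.+1)%N%:R * f k.+1));
  last first.
  by move=> k /andP[_ kN]; rewrite -mulr_suml (@tau_sum _ N).
(* Both sides are expressed by [g], the sum over all pairs with product at
   most [N]; a pair with one factor greater than [w] has the other at most [w]. *)
rewrite exchange_big_nat /=.
rewrite (eq_bigr (fun i => \sum_(0 <= j < N) g i j)); last first.
  by move=> i _; rewrite sum_pairs_dvdn // inner.
rewrite [in RHS](eq_bigr (fun i => \sum_(0 <= j < N) g i j)); last first.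
  by move=> i _; rewrite inner.
rewrite (big_cat_nat _ wN') //=.
have -> : \sum_(w <= i < N) \sum_(0 <= j < N) g i j =
    \sum_(w <= i < N) \sum_(0 <= j < w) g i j.
  apply: eq_big_nat => i /andP[wi _].
  rewrite (big_cat_nat _ wN') //= [X in _ + X]big_nat_cond.
  rewrite [X in _ + X]big1 ?addr0 //.
  move=> j /andP[/andP[wj _] _]; rewrite /g leqNgt (leq_trans Nw) //.
  by rewrite expnS expn1 leq_mul.
rewrite [X in _ + X = _]exchange_big_nat /=.
have E : \sum_(0 <= i < w) \sum_(0 <= j < N) g i j =
    \sum_(0 <= i < w) \sum_(0 <= j < w) f (i.+1 * j.+1)%N +
    \sum_(0 <= j < w) \sum_(w <= i < N) g i j.
  rewrite -big_split /=; apply: eq_big_nat => i /andP[_ iw].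
  rewrite (big_cat_nat _ wN') //=; congr (_ + _).
    apply: eq_big_nat => j /andP[_ jw]; rewrite /g (leq_trans _ wN) //.
    by rewrite expnS expn1 leq_mul.
  by apply: eq_bigr => j _; rewrite gC.
by rewrite E; ring.
Qed.

Lemma trunc_inv_anti n N (t : R) : (0 < n <= N)%N -> 0 <= t ->
  trunc_inv N t <= trunc_inv n t.
Proof.
move=> /andP[n0 nN]; rewrite le_eqVlt => /orP[/eqP <-|t0].
  by rewrite /trunc_inv !mulr0 !invr0.
rewrite /trunc_inv le_min ge_min lexx /= ge_min; apply/orP; right.
rewrite lef_pV2 ?posrE ?mulr_gt0 ?ltr0n // ?(leq_trans n0) //.
by rewrite ler_pM2r // ler_nat.
Qed.

(** The distances from [t] to the integers below and above it. *)
Definition trunc_inv2 N (t : R) := trunc_inv N (frac t) + trunc_inv N (frac (- t)).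

Lemma trunc_inv2_ge0 N t : 0 <= trunc_inv2 N t.
Proof. by rewrite addr_ge0 // trunc_inv_ge0 // frac_ge0. Qed.

Lemma sawtooth_err2 n N (t : R) : (0 < n <= N)%N ->
  `|sawtooth_sum N t - B1 t| <= 3 * trunc_inv2 n t.
Proof.
move=> /andP[n0 nN]; have [tint|tint] := boolP (t \is a Num.int).
  rewrite sawtooth_int // /B1 tint subrr normr0 mulr_ge0 //.
  exact: trunc_inv2_ge0.
apply: le_trans (sawtooth_err (leq_trans n0 nN) tint) _.
by rewrite ler_pM2l // lerD // trunc_inv_anti ?n0 ?frac_ge0.
Qed.

(** Replacing the inner sums of the hyperbola by their limits turns the
    divisor series up to [N] into [phi1] up to the square root of [N]. *)
Lemma psi1_sub_phi1 (x : R) N w : (w ^ 2 <= N < w.+1 ^ 2)%N ->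
  `|series (psi1_term x) N - series (phi1_term x) w| <=
  9 * \sum_(0 <= k < w) trunc_inv2 w (k.+1%:R * x) / k.+1%:R.
Proof.
move=> wN; have /andP[wN1 _] := wN.
pose f n : R := - pi^-1 * (sin (2 * pi * n%:R * x) / n%:R).
have -> : series (psi1_term x) N = \sum_(0 <= k < N) (tau k.+1)%:R * f k.+1.
  by apply: eq_bigr => k _; rewrite /psi1_term /f; ring.
have inner i J : \sum_(0 <= j < J) f (i.+1 * j.+1)%N =
    sawtooth_sum J (i.+1%:R * x) / i.+1%:R.
  rewrite /sawtooth_sum mulr_sumr mulr_suml; apply: eq_bigr => j _.
  rewrite /f natrM invfM.
  have -> : 2 * pi * (i.+1%:R * j.+1%:R) * x = 2 * pi * j.+1%:R * (i.+1%:R * x).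
    by ring.
  by ring.
rewrite (hyperbola _ wN).
rewrite (eq_bigr _ (fun i _ => inner i (N %/ i.+1)%N)).
rewrite [X in _ * _ - X](eq_bigr _ (fun i _ => inner i w)).
rewrite [2 * _]mulr_sumr [9 * _]mulr_sumr /series /= -sumrB -sumrB.
apply: le_trans (ler_norm_sum _ _ _) _.
apply: ler_sum_nat => i /andP[_ iw].
rewrite /phi1_term.
set t := i.+1%:R * x.
have -> : 2 * (sawtooth_sum (N %/ i.+1) t / i.+1%:R) - sawtooth_sum w t / i.+1%:R -
    B1 t / i.+1%:R =
    (2 * (sawtooth_sum (N %/ i.+1) t - B1 t) - (sawtooth_sum w t - B1 t)) / i.+1%:R.
  by ring.
rewrite normrM normfV normr_nat mulrA ler_pM2r ?invr_gt0 ?ltr0n //.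
apply: le_trans (ler_normB _ _) _; rewrite normrM ger0_norm //.
have w0 : (0 < w)%N by apply: leq_ltn_trans iw.
have wNi : (w <= N %/ i.+1)%N.
  rewrite leq_divRL //; apply: leq_trans wN1.
  by rewrite expnS expn1 leq_mul.
have := @sawtooth_err2 w (N %/ i.+1) t; rewrite w0 wNi => /(_ isT).
have := @sawtooth_err2 w w t; rewrite w0 leqnn => /(_ isT).
lra.
Qed.

End Hyperbola.

(** * Sums over spaced points *)

Section SpacedSums.
Context {R : realType}.
Implicit Types (n k m i j J M : nat).
Notation fl := Num.truncn.

Lemma sum_at_most_one (P : pred nat) n :
  (forall i j, (i < j)%N -> (j < n)%N -> P i -> P j -> False) ->
  \sum_(0 <= i < n) (P i)%:R <= 1 :> R.
Proof.
elim: n => [|n IHn] h; first by rewrite big_geq.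
rewrite big_nat_recr //=.
have [Pn|Pn] := boolP (P n); last first.
  by rewrite addr0 IHn // => i j ij jn; apply: h => //; rewrite ltnS ltnW.
rewrite big_nat_cond big1 ?add0r // => i /andP[/andP[_ ni] _].
case: (boolP (P i)) => // Pi; exfalso; exact: (h i n ni).
Qed.

Lemma sum_sqV_tail m n : (0 < m)%N ->
  \sum_(m <= k < n) (k.+1%:R ^- 2) <= m%:R^-1 :> R.
Proof.
move=> m0; suff h : (m <= n)%N ->
    \sum_(m <= k < n) (k.+1%:R ^- 2) <= m%:R^-1 - n%:R^-1 :> R.
  have [/h mn|nm] := leqP m n.
    by apply: le_trans mn _; rewrite lerBlDr lerDl.
  by rewrite big_geq ?invr_ge0 // ltnW.
move=> /subnK <-; elim: (n - m)%N => [|k IHk]; first by rewrite big_geq // subrr.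
rewrite addSn big_nat_recr ?leq_addl //=.
have k0 : 0 < (k + m)%:R :> R by rewrite ltr0n addn_gt0 m0 orbT.
suff : (k + m).+1%:R ^- 2 <= (k + m)%:R^-1 - (k + m).+1%:R^-1 :> R.
  by move=> h; apply: le_trans (lerD IHk h) _; rewrite addrA subrK.
rewrite -natr1; move: (k + m)%:R k0 => a a0.
have -> : a^-1 - (a + 1)^-1 = (a * (a + 1))^-1.
  by field; rewrite !gt_eqF // addr_gt0.
rewrite lef_pV2 ?posrE ?exprn_gt0 ?mulr_gt0 ?addr_gt0 //.
by rewrite expr2 ler_pM2r ?addr_gt0 // lerDl.
Qed.

Lemma sum_sqV_le2 n : \sum_(0 <= k < n) (k%:R ^- 2) <= 2 :> R.
Proof.
case: n => [|n]; first by rewrite big_geq.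
rewrite big_nat_recl //= expr0n /= invr0 add0r.
case: n => [|n]; first by rewrite big_geq.
rewrite big_nat_recl //= expr1n invr1.
have -> : \sum_(0 <= i < n) (i.+2%:R ^- 2) = \sum_(1 <= i < n.+1) (i.+1%:R ^- 2) :> R.
  by rewrite big_add1.
have := @sum_sqV_tail 1 n.+1 isT; rewrite invr1; lra.
Qed.

(** Distinct values of a key cannot contribute more than the sum over all
    keys. *)
Lemma sum_inj_le (g : nat -> R) (key : nat -> nat) q n :
  (forall a, 0 <= g a) -> (forall i, (i < q)%N -> (key i < n)%N) ->
  (forall i j, (i < j)%N -> (j < q)%N -> key i <> key j) ->
  \sum_(0 <= i < q) g (key i) <= \sum_(0 <= a < n) g a.
Proof.
move=> g0 kn kinj.
have -> : \sum_(0 <= i < q) g (key i) =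
    \sum_(0 <= i < q) \sum_(0 <= a < n) (key i == a)%:R * g a.
  apply: eq_big_nat => i /andP[_ iq].
  rewrite (eq_bigr (fun a => if a == key i then g a else 0)); last first.
    by move=> a _; rewrite eq_sym; case: eqP => _; rewrite ?mul1r ?mul0r.
  by rewrite -big_mkcond big_nat1_eq /= kn.
rewrite exchange_big_nat /=; apply: ler_sum => a _; rewrite -mulr_suml.
rewrite ler_piMl //; apply: sum_at_most_one => i j ij jq /eqP ki /eqP kj.
by apply: (kinj i j ij jq); rewrite ki kj.
Qed.

Variables (t : nat -> R) (q w : nat) (B : R).
Hypothesis t01 : forall m, 0 <= t m < 1.
Hypothesis t0 : t 0%N = 0.
Hypothesis B0 : 0 < B.
Hypothesis q0 : (0 < q)%N.
Hypothesis qB : 1 <= 2 * (q%:R * B).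
Hypothesis qB1 : q%:R * B <= 1.
Hypothesis spaced : forall i j, (i < j)%N -> (j < i + q)%N -> B <= `|t j - t i|.
Hypothesis wB : 1 <= B * w%:R.

(* The cell of length [B] that contains the [m]-th point; the points of [q]
   consecutive indices lie in distinct cells. *)
Let key m := fl (t m / B).

Lemma key_neq i j : (i < j)%N -> (j < i + q)%N -> key i <> key j.
Proof.
move=> ij jq E; have := spaced ij jq; apply/negP; rewrite -ltNge.
have d m : 0 <= t m / B by rewrite divr_ge0 ?(ltW B0) //; case/andP: (t01 m).
have /andP[i1 i2] := truncn_itv (d i); have /andP[j1 j2] := truncn_itv (d j).
move: i1 i2; rewrite -/(key i) E ler_pdivlMr // ltr_pdivrMr // => i1 i2.
move: j1 j2; rewrite -/(key j) ler_pdivlMr // ltr_pdivrMr // => j1 j2.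
move: i2 j2; rewrite -natr1 mulrDl mul1r => i2 j2.
rewrite ltr_norml; lra.
Qed.

(* A bound for the number of cells. *)
Let n := (fl B^-1).+1.

Lemma key_lt m : (key m < n)%N.
Proof.
rewrite ltnS le_truncn // ler_pdivrMr // mulVf ?gt_eqF //.
by have /andP[_ /ltW] := t01 m.
Qed.

Lemma block_key_inj k i j : (i < j)%N -> (j < q)%N -> key (k * q + i) <> key (k * q + j).
Proof. by move=> ij jq; apply: key_neq; rewrite ?ltn_add2l // -addnA ltn_add2l ltn_addl. Qed.

(* The number of blocks of [q] indices needed to cover the indices up to [w]. *)
Let J := (w %/ q).+1.

Lemma sum_blocks (c : nat -> R) : (forall m, 0 <= c m) ->
  \sum_(0 <= m < w) c m.+1 <=
  \sum_(0 <= k < J) \sum_(0 <= i < q) c (k * q + i)%N.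
Proof.
move=> c0.
have wJ : (w.+1 <= J * q)%N by apply: ltn_ceil.
have -> : \sum_(0 <= k < J) \sum_(0 <= i < q) c (k * q + i)%N =
    \sum_(0 <= m < J * q) c m.
  rewrite big_nat_mul; apply: eq_bigr => k _.
  transitivity (\sum_(0 + k * q <= j < q + k * q) c j); last by rewrite add0n mulSn.
  rewrite big_addn addnK.
  by apply: eq_bigr => i _; rewrite addnC.
rewrite (big_cat_nat _ wJ) //= big_nat_recl // -addrA addrCA lerDl.
by rewrite addr_ge0 // sumr_ge0.
Qed.

(** Each block contributes at most the sum of the inverse squares, cell 0 counting
    for nothing since [0^-1 = 0]. *)
Lemma far_sum : \sum_(0 <= m < w) ((key m.+1)%:R ^- 2) <= 4 * (B * w%:R) * 2 :> R.
Proof.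
apply: le_trans (sum_blocks (c := fun m => (key m)%:R ^- 2) _) _.
  by move=> m; rewrite invr_ge0 exprn_ge0.
apply: le_trans (_ : \sum_(0 <= k < J) 2 <= _).
  apply: ler_sum => k _.
  apply: le_trans (sum_inj_le (g := fun a => a%:R ^- 2) (n := n) _ _ _) _.
  - by move=> a; rewrite invr_ge0 exprn_ge0.
  - by move=> i _; exact: key_lt.
  - exact: block_key_inj.
  exact: sum_sqV_le2.
rewrite sumr_const_nat subn0 -[2 *+ J]mulr_natl ler_pM2r //.
have qw : (w %/ q)%:R * q%:R <= w%:R :> R by rewrite -natrM ler_nat leq_trunc_div.
have q1 : 0 < q%:R :> R by rewrite ltr0n.
have : (w %/ q)%:R <= 2 * (B * w%:R).
  apply: (@le_trans _ _ ((w %/ q)%:R * (2 * (q%:R * B)))).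
    by rewrite ler_peMr.
  rewrite (_ : _ * _ = (w %/ q)%:R * q%:R * (2 * B)); last by ring.
  rewrite (_ : 2 * (B * w%:R) = w%:R * (2 * B)); last by ring.
  by rewrite ler_pM2r ?mulr_gt0.
have -> : J%:R = (w %/ q)%:R + 1 :> R by rewrite natr1.
by move: wB; lra.
Qed.

(** At most one index per block falls in cell 0, and in the block of index 0 it is
    the index 0 itself, which the sum omits: the bound is a harmonic sum over the
    other blocks, divided by [q]. *)
Lemma near_sum :
  \sum_(0 <= m < w) (key m.+1 == 0%N)%:R / m.+1%:R <=
  2 * B * (2 + ln (B * w%:R)) :> R.
Proof.
apply: le_trans (sum_blocks (c := fun m => (key m == 0%N)%:R / m%:R) _) _.
  by move=> m; rewrite divr_ge0.
have q1 : 0 < q%:R :> R by rewrite ltr0n.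
have key0 : key 0 = 0%N by rewrite /key t0 mul0r truncn0.
rewrite big_nat_recl //= [X in X + _]big_nat_cond [X in X + _]big1 ?add0r; last first.
  move=> [|i] /andP[/andP[_ iq] _]; first by rewrite invr0 mulr0.
  have := @key_neq 0 i.+1 isT iq; rewrite key0 mul0n add0n.
  by case: eqP => [->//|_]; rewrite mul0r.
apply: le_trans (_ : \sum_(0 <= k < w %/ q) k.+1%:R^-1 / q%:R <= _).
  apply: ler_sum => k _.
  apply: le_trans (_ : \sum_(0 <= i < q) (key (k.+1 * q + i) == 0%N)%:R * (k.+1%:R^-1 / q%:R) <= _).
    apply: ler_sum => i _; rewrite ler_wpM2l // -invfM.
    rewrite lef_pV2 ?posrE ?mulr_gt0 ?ltr0n // ?addn_gt0 ?muln_gt0 ?q0 //.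
    by rewrite -natrM ler_nat mulnC leq_addr.
  rewrite -mulr_suml ler_piMl ?divr_ge0 ?invr_ge0 //.
  apply: sum_at_most_one => i j ij jq /eqP ki /eqP kj.
  by apply: (block_key_inj (k := k.+1) ij jq); rewrite ki kj.
rewrite -mulr_suml -/(harm (w %/ q)).
have w0 : 0 < w%:R :> R.
  rewrite ltr0n lt0n; apply/negP => /eqP w0; move: wB.
  by rewrite w0 mulr0 ler10.
have qw : (q <= w)%N.
  rewrite -(ler_nat R) -(ler_pM2r B0) [leRHS]mulrC; exact: le_trans qB1 wB.
have flw : fl (w%:R / q%:R : R) = (w %/ q)%N.
  apply: truncn_def; rewrite ler_pdivlMr // ltr_pdivrMr // -!natrM.
  by rewrite ler_nat ltr_nat leq_trunc_div ltn_ceil.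
have h : harm (w %/ q) <= 2 + ln (B * w%:R) :> R.
  rewrite -flw; apply: le_trans (harm_le_ln _) _.
    by rewrite ler_pdivlMr // mul1r ler_nat.
  have -> : 2 + ln (B * w%:R) = 1 + (1 + ln (B * w%:R)) by ring.
  rewrite lerD2l.
  apply: (@le_trans _ _ (ln (2 * (B * w%:R)))).
    apply: ln_le; first by rewrite divr_gt0.
    rewrite ler_pdivrMr //.
    rewrite (_ : 2 * _ * _ = w%:R * (2 * (q%:R * B))); last by ring.
    by rewrite ler_peMr // ltW.
  rewrite lnM ?posrE ?mulr_gt0 // lerD2r.
  by have := @ln_le_sub1 R 2; lra.
have ln0 : 0 <= ln (B * w%:R) by rewrite ln_ge0.
have qV : q%:R^-1 <= 2 * B.
  by rewrite -div1r ler_pdivrMr // mulrAC -mulrA.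
by rewrite mulrC; apply: ler_pM => //; apply: sumr_ge0.
Qed.

(** The sum is split into the indices at most [M], those whose point falls in
    the first cell of length [B] (at most one per block of [q] indices, none in
    the first block), and the others, to which the inequality between
    arithmetic and geometric means is applied with weight [l]. *)
Lemma spaced_sum M l : (0 < M)%N -> 0 < l ->
  \sum_(0 <= m < w) trunc_inv w (t m.+1) / m.+1%:R <=
  \sum_(0 <= m < M) trunc_inv w (t m.+1) / m.+1%:R +
  2 * B * (2 + ln (B * w%:R)) + l / M%:R + 4 / l.
Proof.
move=> M0 l0.
have w0 : 0 < w%:R :> R.
  rewrite ltr0n lt0n; apply/negP => /eqP w0; move: wB.
  by rewrite w0 mulr0 ler10.
have u0 m : 0 <= trunc_inv w (t m.+1) / m.+1%:R.
  by rewrite divr_ge0 // trunc_inv_ge0 //; case/andP: (t01 m.+1).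
set S0 := \sum_(0 <= m < M) _.
have S00 : 0 <= S0 by rewrite sumr_ge0.
have point m : trunc_inv w (t m.+1) / m.+1%:R <=
   (key m.+1 == 0%N)%:R / m.+1%:R + l / 2 * m.+1%:R ^- 2 +
   (2 * l)^-1 * (B * w%:R) ^- 2 * (key m.+1)%:R ^- 2.
  have m0 : 0 < m.+1%:R :> R by rewrite ltr0n.
  have k0 : 0 <= (key m.+1)%:R ^- 2 :> R by rewrite invr_ge0 exprn_ge0.
  have v0 : 0 <= (B * w%:R) ^- 2 by rewrite invr_ge0 exprn_ge0 // ltW // mulr_gt0.
  have l20 : 0 <= (2 * l)^-1 by rewrite invr_ge0 mulr_ge0 // ltW.
  have lm : 0 <= l / 2 * m.+1%:R ^- 2.
    by rewrite mulr_ge0 ?divr_ge0 ?invr_ge0 ?exprn_ge0 ?(ltW l0).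
  case: eqP => [k00|/eqP k00].
    rewrite mul1r -addrA ler_wpDr //; first by rewrite addr_ge0 // !mulr_ge0.
    by rewrite ler_piMl ?invr_ge0 // /trunc_inv ge_min lexx.
  rewrite mul0r add0r.
  have kp : 0 < (key m.+1)%:R :> R by rewrite ltr0n lt0n.
  have d : 0 <= t m.+1 / B by rewrite divr_ge0 ?(ltW B0) //; case/andP: (t01 m.+1).
  have kt : (key m.+1)%:R * B <= t m.+1.
    by have /andP[] := truncn_itv d; rewrite ler_pdivlMr.
  apply: (@le_trans _ _ (((B * w%:R) * (key m.+1)%:R)^-1 * m.+1%:R^-1)).
    rewrite ler_pM2r ?invr_gt0 // /trunc_inv ge_min; apply/orP; right.
    rewrite lef_pV2 ?posrE ?mulr_gt0 ?(lt_le_trans _ kt) ?mulr_gt0 //.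
    rewrite (_ : _ * _ * _ = w%:R * ((key m.+1)%:R * B)); last by ring.
    by rewrite ler_pM2l.
  have -> : (2 * l)^-1 * (B * w%:R) ^- 2 * (key m.+1)%:R ^- 2 =
      (2 * l)^-1 * ((B * w%:R * (key m.+1)%:R)^-1) ^+ 2.
    by rewrite -mulrA; congr (_ * _); rewrite -!exprVn -exprMn -invfM.
  rewrite -exprVn; move: (_^-1) (m.+1%:R^-1) => a b.
  rewrite -subr_ge0 (_ : _ - _ = (l * b - a) ^+ 2 / (2 * l)).
    by rewrite divr_ge0 ?sqr_ge0 // mulr_ge0 // ltW.
  by field; rewrite gt_eqF.
have far := far_sum; have near := near_sum.
have [wM|Mw] := leqP w M.
  rewrite -[leLHS]addr0 -!addrA; apply: lerD.
    rewrite /S0 (big_cat_nat _ wM) //= lerDl.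
    by rewrite big_nat_cond sumr_ge0.
  have : 0 <= 2 * B * (2 + ln (B * w%:R)).
    by rewrite mulr_ge0 ?addr_ge0 ?ln_ge0 // mulr_ge0 // ltW.
  have : 0 <= l / M%:R by rewrite divr_ge0 // ltW.
  have : 0 <= 4 / l by rewrite divr_ge0 // ltW.
  lra.
rewrite (big_cat_nat _ (ltnW Mw)) //= -/S0 -!addrA lerD2l.
apply: le_trans (ler_sum_nat (fun m _ => point m)) _.
rewrite !big_split /= -!mulr_sumr.
have sub (f : nat -> R) : (forall m, 0 <= f m) ->
    \sum_(M <= m < w) f m <= \sum_(0 <= m < w) f m.
  move=> f0; rewrite [leRHS](big_cat_nat _ (ltnW Mw)) //= lerDr.
  by rewrite sumr_ge0.
have H1 : \sum_(M <= m < w) (key m.+1 == 0%N)%:R / m.+1%:R <= 2 * B * (2 + ln (B * w%:R)).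
  by apply: le_trans near; apply: (sub (fun m => (key m.+1 == 0%N)%:R / m.+1%:R)).
have H2 : l / 2 * (\sum_(M <= m < w) m.+1%:R ^- 2) <= l / M%:R.
  apply: (@le_trans _ _ (l / 2 * M%:R^-1)).
    by rewrite ler_pM2l ?divr_gt0 // sum_sqV_tail.
  by rewrite ler_pM2r ?invr_gt0 ?ltr0n //; lra.
have H3 : (2 * l)^-1 * (B * w%:R) ^- 2 * (\sum_(M <= m < w) (key m.+1)%:R ^- 2) <= 4 / l.
  have X0 : 0 < B * w%:R by rewrite mulr_gt0.
  apply: (@le_trans _ _ ((2 * l)^-1 * (B * w%:R) ^- 2 * (4 * (B * w%:R) * 2))).
    rewrite ler_pM2l ?mulr_gt0 ?invr_gt0 ?exprn_gt0 ?mulr_gt0 //.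
    apply: le_trans far; apply: (sub (fun m => (key m.+1)%:R ^- 2)).
    by move=> m; rewrite invr_ge0 exprn_ge0.
  rewrite (_ : _ * _ = 4 / l * (B * w%:R)^-1); last first.
    by move: (B * w%:R) X0 => X X0; field; rewrite !gt_eqF.
  by rewrite ler_piMr ?divr_ge0 ?(ltW l0) // invf_le1.
apply: le_trans (lerD (lerD H1 H2) H3) _; lra.
Qed.

End SpacedSums.

(** * Convergents and irrational points *)

Section Convergents.
Context {R : realType}.
Variable x : R.
Hypothesis alpha01 : forall j, 0 < alpha j x < 1.
Implicit Types (n m K N w : nat).
Notation fl := Num.truncn.
Notation r := (9 / 10 : R).

(** [p / q] and [p' / q'] are consecutive convergents of [x]. *)
Lemma convergents K : exists q q' : nat, exists p p' : int,
  [/\ (0 < q)%N, (q' <= q)%N, q%:R * x - p%:~R = (-1) ^+ K * beta K.+1 x,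
      q'%:R * x - p'%:~R = - (-1) ^+ K * beta K x
    & q%:Z * p' - q'%:Z * p = (-1) ^+ K].
Proof.
elim: K => [|K [q [q' [p [p' [q0 qq' E E' det]]]]]].
  exists 1%N, 0%N, 0, 1; split => //.
    by rewrite betaS beta0 !mul1r subr0.
  by rewrite beta0 mul0r sub0r mulr1 expr0.
pose a := fl (alpha K x)^-1.
have /andP[a0 a1] := alpha01 K.
have a_gt0 : (0 < a)%N by rewrite truncn_gt0 invf_ge1 // ltW.
exists (a * q + q')%N, q, (a%:Z * p + p'), p; split => //.
- by rewrite addn_gt0 muln_gt0 a_gt0 q0.
- by apply: leq_trans (leq_addr _ _); rewrite leq_pmull.
- have aE : alpha K.+1 x = (alpha K x)^-1 - a%:R.
    by rewrite alphaS frac_truncn // invr_ge0 ltW.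
  have -> : (a * q + q')%:R * x - (a%:Z * p + p')%:~R =
      a%:R * (q%:R * x - p%:~R) + (q'%:R * x - p'%:~R).
    by rewrite natrD natrM intrD intrM; ring.
  rewrite E E' [beta K.+2 x]betaS aE [beta K.+1 x]betaS exprS.
  by field; rewrite gt_eqF.
- by rewrite E exprS mulN1r opprK.
- rewrite exprS -det PoszD PoszM; ring.
Qed.

(** The determinant of two consecutive convergents is [(-1)^K], so every [(m, n)]
    is an integral combination, with coefficients [u] and [v], of [(q, p)] and
    [(q', p')]. For [0 < m < q] the coefficient [v] is nonzero and [u] does not have
    its sign, whence the two contributions to [m x - n], of sizes [|u| beta_(K+1)]
    and [|v| beta_K], do not cancel. *)
Lemma convergent_spacing K : exists q : nat,
  [/\ (0 < q)%N, 1 <= 2 * (q%:R * beta K x), q%:R * beta K x <= 1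
    & forall (m : nat) (n : int), (0 < m < q)%N -> beta K x <= `|m%:R * x - n%:~R|].
Proof.
have [q [q' [p [p' [q0 qq' E E' det]]]]] := convergents K.
have b0 := beta_gt0 alpha01 K; have b1 := beta_gt0 alpha01 K.+1.
have b01 := beta_leS alpha01 K.
have sg2 : (-1) ^+ K * (-1) ^+ K = 1 :> R by rewrite -exprMn mulrNN mul1r expr1n.
have sgz2 : (-1) ^+ K * (-1) ^+ K = 1 :> int by rewrite -exprMn mulrNN mul1r expr1n.
have qb : q%:R * beta K x + q'%:R * beta K.+1 x = 1.
  have dR : q%:R * p'%:~R - q'%:R * p%:~R = (-1) ^+ K :> R.
    have := congr1 (fun z : int => z%:~R : R) det.
    by rewrite intrB !intrM rmorphXn /= rmorphN1.
  transitivity (- ((-1) ^+ K * (q%:R * (- (-1) ^+ K * beta K x) -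
     q'%:R * ((-1) ^+ K * beta K.+1 x)))).
    transitivity ((-1) ^+ K * (-1) ^+ K * (q%:R * beta K x + q'%:R * beta K.+1 x)).
      by rewrite sg2 mul1r.
    by ring.
  rewrite -E -E'; transitivity ((-1) ^+ K * (q%:R * p'%:~R - q'%:R * p%:~R) : R).
    by ring.
  by rewrite dR sg2.
have qR : 0 < q%:R :> R by rewrite ltr0n.
have q'q : q'%:R <= q%:R :> R by rewrite ler_nat.
have q'0 : 0 <= q'%:R :> R by [].
have le1 : q'%:R * beta K.+1 x <= q%:R * beta K x by rewrite ler_pM // ltW.
have ge0 : 0 <= q'%:R * beta K.+1 x by rewrite mulr_ge0 // ltW.
exists q; split => //; [lra|lra|].
move=> m n /andP[m0 mq].
pose u := (-1) ^+ K * (m%:Z * p' - n * q'%:Z).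
pose v := (-1) ^+ K * (n * q%:Z - m%:Z * p).
have mE : m%:Z = u * q%:Z + v * q'%:Z.
  transitivity ((-1) ^+ K * (m%:Z * (q%:Z * p' - q'%:Z * p))).
    by rewrite det mulrCA sgz2 mulr1.
  by rewrite /u /v; ring.
have nE : n = u * p + v * p'.
  transitivity ((-1) ^+ K * (n * (q%:Z * p' - q'%:Z * p))).
    by rewrite det mulrCA sgz2 mulr1.
  by rewrite /u /v; ring.
clearbody u v.
have dE : m%:R * x - n%:~R = (-1) ^+ K * (u%:~R * beta K.+1 x - v%:~R * beta K x).
  have -> : m%:R = u%:~R * q%:R + v%:~R * q'%:R :> R.
    by rewrite -[m%:R]/(m%:Z%:~R) mE intrD !intrM.
  rewrite {1}nE intrD !intrM.
  transitivity (u%:~R * (q%:R * x - p%:~R) + v%:~R * (q'%:R * x - p'%:~R)).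
    by ring.
  by rewrite E E'; ring.
rewrite dE normrM normrX normrN1 expr1n mul1r.
have [v0|v0] := ltP 0 v.
  have u0 : u <= 0.
    rewrite leNgt; apply/negP => u0.
    have : q%:Z <= m%:Z.
      rewrite mE; have : 0 <= v * q'%:Z by rewrite mulr_ge0 // ltW.
      have : q%:Z <= u * q%:Z by rewrite ler_peMl.
      lia.
    by rewrite lez_nat leqNgt mq.
  have v1 : 1 <= v%:~R :> R by rewrite ler1z.
  have u1 : u%:~R <= 0 :> R by rewrite lerz0.
  have h1 : beta K x <= v%:~R * beta K x by rewrite ler_peMl // ltW.
  have h2 : u%:~R * beta K.+1 x <= 0 by rewrite mulr_le0_ge0 // ltW.
  rewrite ler0_norm; lra.
have u0 : 0 < u.
  rewrite ltNge; apply/negP => u0.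
  have : m%:Z <= 0.
    rewrite mE; have : v * q'%:Z <= 0 by rewrite mulr_le0_ge0.
    have : u * q%:Z <= 0 by rewrite mulr_le0_ge0.
    lia.
  by rewrite lez_nat leqNgt m0.
have u1 : 1 <= u%:~R :> R by rewrite ler1z.
have h1 : beta K.+1 x <= u%:~R * beta K.+1 x by rewrite ler_peMl // ltW.
have [v00|v00] := eqVneq v 0.
  exfalso; move: mq; rewrite ltnNge => /negP; apply.
  rewrite -lez_nat mE v00 mul0r addr0 ler_peMl //.
have v1 : v%:~R <= - 1 :> R.
  rewrite -[X in _ <= X]/((-1)%:~R) ler_int; lia.
have h2 : beta K x <= - (v%:~R * beta K x).
  by rewrite -mulNr ler_peMl ?(ltW b0) //; lra.
rewrite ger0_norm; lra.
Qed.

(** Both signs of [y] are needed because the points are measured from the integer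
    below; the distance from the integer above is that of the opposite point. *)
Lemma frac_spacing K (q : nat) (y : R) : y = x \/ y = - x ->
  (forall (m : nat) (n : int), (0 < m < q)%N -> beta K x <= `|m%:R * x - n%:~R|) ->
  forall i j : nat, (i < j)%N -> (j < i + q)%N ->
  beta K x <= `|frac (j%:R * y) - frac (i%:R * y)|.
Proof.
move=> yx h i j ij jq.
have ji : (0 < j - i < q)%N by rewrite subn_gt0 ij ltn_subLR // ltnW.
have jiR : (j - i)%:R = j%:R - i%:R :> R by rewrite natrB // ltnW.
case: yx => ->.
  have := h _ (Num.floor (j%:R * x) - Num.floor (i%:R * x)) ji.
  rewrite jiR intrB /frac; congr (_ <= `| _ |); ring.
have := h _ (Num.floor (i%:R * - x) - Num.floor (j%:R * - x)) ji.
rewrite jiR intrB /frac -normrN; congr (_ <= `| _ |); ring.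
Qed.

(** The indices up to a fixed [M] contribute [O(1 / w)], because the [m]-th point
    does not depend on [w]; the parameters [l] and [M] of [spaced_sum] are chosen in
    this order to make the remaining constants small. *)
Lemma one_sided_sum (y : R) : y = x \/ y = - x ->
  forall e, 0 < e -> exists w0, forall w K, (w0 <= w)%N -> 1 <= beta K x * w%:R ->
  \sum_(0 <= k < w) trunc_inv w (frac (k.+1%:R * y)) / k.+1%:R <=
  e + 4 * (beta K x + beta K x * ln (beta K x * w%:R)).
Proof.
move=> yx e e0.
pose l := 16 / e; have l0 : 0 < l by rewrite divr_gt0.
pose M := (fl (4 * l / e)).+1.
have M0 : 0 < M%:R :> R by rewrite ltr0n.
have lM : l / M%:R <= e / 4.
  rewrite ler_pdivrMr // mulrC -ler_pdivrMr ?divr_gt0 //.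
  apply: le_trans (ltW (truncnS_gt _)).
  by rewrite le_eqVlt; apply/orP; left; apply/eqP; field; rewrite gt_eqF.
have l4 : 4 / l = e / 4 by rewrite /l; field; rewrite gt_eqF.
pose D := \sum_(0 <= m < M) (frac (m.+1%:R * y))^-1 / m.+1%:R.
have D0 : 0 <= D.
  by rewrite sumr_ge0 // => m _; rewrite divr_ge0 ?invr_ge0 ?frac_ge0.
exists (fl (4 * D / e)).+1 => w K ww0 bw.
have w0 : (0 < w)%N by apply: leq_trans ww0.
have wR : 0 < w%:R :> R by rewrite ltr0n.
have Dw : w%:R^-1 * D <= e / 4.
  rewrite mulrC ler_pdivrMr // -ler_pdivrMl ?divr_gt0 //.
  apply: (@le_trans _ _ (fl (4 * D / e)).+1%:R); last by rewrite ler_nat.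
  apply: le_trans (ltW (truncnS_gt _)).
  by rewrite le_eqVlt; apply/orP; left; apply/eqP; field; rewrite gt_eqF.
have [q [q0 qb1 qb2 sp]] := convergent_spacing K.
have b0 := beta_gt0 alpha01 K.
have fsp := frac_spacing yx sp.
have t01 m : 0 <= frac (m%:R * y) < 1 by rewrite frac_ge0 frac_lt1.
have t00 : frac (0%:R * y) = 0 by rewrite mul0r frac_id ?lexx ?ltr01.
have := @spaced_sum R (fun m => frac (m%:R * y)) q w (beta K x) t01 t00 b0 q0
  qb1 qb2 fsp bw M l (ltn0Sn _) l0.
have : \sum_(0 <= m < M) trunc_inv w (frac (m.+1%:R * y)) / m.+1%:R <= w%:R^-1 * D.
  rewrite /D mulr_sumr; apply: ler_sum => m _.
  rewrite mulrA ler_pM2r ?invr_gt0 // -invfM /trunc_inv ge_min lexx orbT //.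
rewrite l4; move: (trunc_inv w) => T.
have : 0 <= beta K x * ln (beta K x * w%:R) by rewrite mulr_ge0 ?ln_ge0 ?(ltW b0).
move: lM Dw b0; lra.
Qed.

Definition isqrt N : nat := fl (Num.sqrt (N%:R : R)).

Lemma isqrtP N : (isqrt N ^ 2 <= N < (isqrt N).+1 ^ 2)%N.
Proof.
have N0 : 0 <= N%:R :> R by [].
have /andP[s1 s2] := truncn_itv (sqrtr_ge0 (N%:R : R)).
rewrite -(ler_nat R) -(ltr_nat R) !natrX -(sqr_sqrtr N0).
by rewrite lerXn2r ?nnegrE ?sqrtr_ge0 //= ltrXn2r // ?nnegrE ?sqrtr_ge0.
Qed.

Lemma isqrt_sqr w : isqrt (w ^ 2) = w.
Proof. by rewrite /isqrt natrX sqrtr_sqr ger0_norm // natrK. Qed.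

(** Through [psi1_sub_phi1] the scale of the [N]-th partial sum is the square root
    of [N]. *)
Lemma psi1_tracks : tracks x (series (psi1_term x)) isqrt.
Proof.
have [C hC] := phi1_tracks alpha01.
(* 72 is the constant 9 of [psi1_sub_phi1] times twice the constant 4 of
   [one_sided_sum]. *)
exists (C + 72) => e e0.
have e2 : 0 < e / 2 by lra.
have e36 : 0 < e / 36 by lra.
have [w1 hw1] := hC _ e2.
have [w2 hw2] := one_sided_sum (or_introl (erefl x)) e36.
have [w3 hw3] := one_sided_sum (or_intror (erefl (- x))) e36.
exists (maxn w1 (maxn w2 w3)) => N K; rewrite !geq_max => /and3P[h1 h2 h3] bw.
have := hw1 _ K h1 bw; have := hw2 _ K h2 bw; have := hw3 _ K h3 bw.
have := psi1_sub_phi1 x (isqrtP N).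
set w := isqrt N in h1 h2 h3 bw *.
have -> : \sum_(0 <= k < w) trunc_inv2 w (k.+1%:R * x) / k.+1%:R =
  \sum_(0 <= k < w) trunc_inv w (frac (k.+1%:R * x)) / k.+1%:R +
  \sum_(0 <= k < w) trunc_inv w (frac (k.+1%:R * - x)) / k.+1%:R.
  by rewrite -big_split /=; apply: eq_bigr => k _; rewrite /trunc_inv2 mulrDl mulrN.
have r0 : 0 <= r ^+ K by rewrite exprn_ge0.
have -> : series (psi1_term x) N - gauss_sum x K =
  (series (psi1_term x) N - series (phi1_term x) w) +
  (series (phi1_term x) w - gauss_sum x K) by ring.
move: (series (psi1_term x) N - _) (series (phi1_term x) w - _) => a b ha hb hc hd.
apply: le_trans (ler_normD _ _) _.
rewrite [(C + 72) * _]mulrDl; lra.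
Qed.

Lemma irrational_point :
  let L := limn (series (G_term x)) -
           limn (series (fun k => (-1) ^+ k * gamma k x)) / 2 in
  [/\ cvgn (series (phi1_term x)) <-> cvgn (series (fun k => (-1) ^+ k * gamma k x)),
      cvgn (series (psi1_term x)) <-> cvgn (series (fun k => (-1) ^+ k * gamma k x))
    & cvgn (series (phi1_term x)) -> phi1 x = L /\ psi1 x = L].
Proof.
have T1 := phi1_tracks alpha01; have T2 := psi1_tracks.
have s1 : forall w0, exists N0, forall N, (N0 <= N)%N -> (w0 <= id N)%N.
  by move=> w0; exists w0.
have s2 : forall w0, exists N0, forall N, (N0 <= N)%N -> (w0 <= isqrt N)%N.
  move=> w0; exists (w0 ^ 2)%N => N wN.
  have /andP[_ h] := isqrtP N; rewrite -ltnS -ltn_sqr; exact: leq_ltn_trans h.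
have i1 w : exists2 N, (w <= N)%N & id N = w by exists w.
have i2 w : exists2 N, (w <= N)%N & isqrt N = w.
  exists (w ^ 2)%N; last exact: isqrt_sqr.
  by case: w => // w; rewrite expnS expn1 leq_pmulr.
have c1 := tracks_cvg alpha01 T1 s1; have c2 := tracks_cvg alpha01 T2 s2.
have g1 := tracks_cvg_gamma alpha01 T1 i1; have g2 := tracks_cvg_gamma alpha01 T2 i2.
split; first by split=> [/g1//|/c1 h]; apply/cvg_ex; eexists; exact: h.
  by split=> [/g2//|/c2 h]; apply/cvg_ex; eexists; exact: h.
by move=> /g1 h; split; apply/cvg_lim => //; [exact: c1|exact: c2].
Qed.

End Convergents.

(** * Rational points *)

Section Rational.
Context {R : realType}.
Implicit Types (x y z : R) (b : seq nat) (q w N K : nat).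
Notation fl := Num.truncn.

(** The conditions that make a continued fraction expansion unique. *)
Definition regular b := all (fun a => 0 < a)%N b /\ (b = [::] \/ (1 < last 0 b)%N).

Lemma regular_behead a b : regular (a :: b) -> regular b.
Proof.
move=> [/= /andP[a0 b0] []] // h; split => //.
by case: b b0 h => [|c b] _ h; [left|right].
Qed.

Lemma regular_drop j b : regular b -> regular (drop j b).
Proof.
elim: j b => [|j IHj] [|a b] rb //; apply: IHj; exact: regular_behead rb.
Qed.

Lemma contfrac_ge0 b : 0 <= contfrac b :> R.
Proof. by elim: b => //= a b IHb; rewrite invr_ge0 addr_ge0. Qed.

Lemma contfrac_itv a b : regular (a :: b) -> 0 < (contfrac (a :: b) : R) < 1.
Proof.
elim: b a => [|c b IHb] a [/= /andP[a0 ab] []] // h.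
  rewrite addr0 invr_gt0 ltr0n a0 invf_lt1 ?ltr0n //.
  by rewrite ltr1n.
have rb : regular (c :: b) by split => //; right.
have /andP[c0 c1] := IHb c rb.
have a1 : 1 <= a%:R :> R by rewrite ler1n.
change (0 < (a%:R + contfrac (c :: b) : R)^-1 < 1).
move: (contfrac (c :: b)) c0 c1 => t c0 c1.
have at0 : 0 < a%:R + t by lra.
by rewrite invr_gt0 invf_lt1 at0 //=; lra.
Qed.

Lemma frac_contfracV a b : regular (a :: b) ->
  frac (contfrac (a :: b))^-1 = contfrac b :> R.
Proof.
move=> rab; rewrite /= invrK addrC -[a%:R]/(a%:Z%:~R) fracDz frac_id //.
rewrite contfrac_ge0 /=; have := regular_behead rab.
by case: b {rab} => [|c b] rb; [exact: ltr01|case/andP: (contfrac_itv rb)].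
Qed.

Lemma alpha_contfrac b j : regular b -> (j <= size b)%N ->
  alpha j (contfrac b) = contfrac (drop j b) :> R.
Proof.
elim: j b => [|j IHj] b rb; first by rewrite drop0.
case: b rb => [|a b] rb // jb; rewrite alphaSr frac_contfracV //.
by rewrite IHj //; exact: regular_behead rb.
Qed.

Lemma betaSr k y : beta k.+1 y = y * beta k (frac y^-1).
Proof.
rewrite /beta big_ord_recl; congr (_ * _); apply: eq_bigr => i _.
by rewrite -alphaSr.
Qed.

(** The denominator is obtained from [beta]: one step replaces [p / q] by
    [q / (a q + p)], the product of this number and [1 / q] being [1 / (a q + p)]. *)
Lemma contfrac_fraction b : regular b -> exists p q : nat,
  [/\ (0 < q)%N, coprime p q, contfrac b = p%:R / q%:R :> R
    & beta (size b) (contfrac b) = q%:R^-1 :> R].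
Proof.
elim: b => [|a b IHb] rb.
  by exists 0%N, 1%N; rewrite /= beta0 invr1 mul0r.
have [p [q [q0 pq E Eb]]] := IHb (regular_behead rb).
have a0 : (0 < a)%N by case: rb => /= /andP[].
have qR : q%:R != 0 :> R by rewrite pnatr_eq0 -lt0n.
have sR : (a * q + p)%:R != 0 :> R by rewrite pnatr_eq0 -lt0n addn_gt0 muln_gt0 a0 q0.
have cE : contfrac (a :: b) = q%:R / (a * q + p)%:R :> R.
  move: sR; rewrite /= E natrD natrM => sR; field.
  by rewrite qR sR.
exists q, (a * q + p)%N; split => //.
- by rewrite addn_gt0 muln_gt0 a0 q0.
- by rewrite /coprime gcdnMDl gcdnC.
- by rewrite betaSr frac_contfracV // Eb cE mulrAC divff // mul1r.
Qed.

(** The Euclidean algorithm. *)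
Lemma fraction_contfrac (p q : nat) : (p < q)%N ->
  exists2 b, regular b & contfrac b = p%:R / q%:R :> R.
Proof.
elim/ltn_ind: p q => p IHp q pq.
case: p IHp pq => [|p] IHp pq.
  by exists [::]; [split => //; left|rewrite /= mul0r].
have [b [ball blast] E] := IHp (q %% p.+1)%N (ltn_pmod _ (ltn0Sn p)) p.+1 (ltn_pmod _ (ltn0Sn p)).
have a0 : (0 < q %/ p.+1)%N by rewrite divn_gt0 // ltnW.
have pR : p.+1%:R != 0 :> R by rewrite pnatr_eq0.
have qR : q%:R = (q %/ p.+1)%:R * p.+1%:R + (q %% p.+1)%:R :> R.
  by rewrite -natrM -natrD -divn_eq.
have q0 : q%:R != 0 :> R by rewrite pnatr_eq0 -lt0n (leq_trans _ pq).
exists (q %/ p.+1 :: b)%N; last first.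
  rewrite /= E; move: q0; rewrite qR.
  move: (_ %/ _)%:R (_ %% _)%:R p.+1%:R pR => u v c c0 s0; field.
  by rewrite c0 s0.
split; first by rewrite /= a0.
right; case: blast => [b0|]; last by case: (b).
move: E; rewrite b0 /= => /esym/eqP.
rewrite mulf_eq0 invr_eq0 (negbTE pR) orbF pnatr_eq0 => /eqP r0.
rewrite ltnNge; apply/negP => a1.
have a1' : (q %/ p.+1 = 1)%N by apply/eqP; rewrite eqn_leq a1 a0.
by move: pq; rewrite (divn_eq q p.+1) r0 a1' mul1n addn0 ltnn.
Qed.

Lemma rational_contfrac y : rational y -> 0 <= y < 1 ->
  exists2 b, regular b & y = contfrac b.
Proof.
move=> /rationalP[a [q ->]] /andP[h0 h1].
case: q h0 h1 => [|q] h0 h1.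
  by exists [::]; [split => //; left|rewrite invr0 mulr0].
case: a h0 h1 => a h0 h1; last first.
  move: h0; rewrite ler_pdivlMr ?ltr0n // mul0r ler0z; by [].
have [|b rb E] := @fraction_contfrac a q.+1; last by exists b.
by move: h1; rewrite ltr_pdivrMr ?ltr0n // mul1r -[a%:~R]/(a%:R) ltr_nat.
Qed.

Lemma denom_fraction (p q : nat) : (0 < q)%N -> coprime p q ->
  denom (p%:R / q%:R : R) = q%:R.
Proof.
move=> q0 pq; rewrite /denom.
set P := (X in xget 0 X).
have P0 : P (p%:~R / q%:~R : rat).
  by rewrite /P /= fmorph_div /= !ratr_int.
have sE : P (xget 0 P) := xgetPex 0 (ex_intro _ _ P0).
set s := xget 0 P in sE *; rewrite /P /= in sE.
have -> : s = (p%:Z%:~R / q%:Z%:~R : rat).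
  by apply: (fmorph_inj (@ratr R)); rewrite /= sE fmorph_div /= !ratr_int.
rewrite coprimeq_den //=.
by case: eqP q0 => [/(congr1 absz) /= ->|].
Qed.

Lemma depthP y : rational y -> 0 <= y < 1 ->
  [/\ forall j, (j < depth y)%N -> 0 < alpha j y < 1,
      alpha (depth y) y = 0,
      beta (depth y) y = (denom y)^-1
    & exists p q : nat, (0 < q)%N /\ y = p%:R / q%:R].
Proof.
move=> ry y01.
have ex : exists K, has_depth y K.
  have [b [b1 b2] yE] := rational_contfrac ry y01.
  by exists (size b), b.
have [b [sb b1 b2 yE]] : has_depth y (depth y) := xgetPex 0%N ex.
have rb : regular b by [].
have [p [q [q0 pq E Eb]]] := contfrac_fraction rb.
rewrite -sb yE; split.
- move=> j jb; rewrite alpha_contfrac ?(ltnW jb) //.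
  have rd := regular_drop j rb.
  case E2 : (drop j b) rd => [|a c]; last by move=> rd; exact: contfrac_itv.
  by move: (size_drop j b); rewrite E2 => /esym/eqP; rewrite subn_eq0 leqNgt jb.
- by rewrite alpha_contfrac // drop_size.
- by rewrite Eb E denom_fraction.
- by exists p, q.
Qed.

(** If [q z] is an integer, so is [q] times the fractional part of [z], which is
    therefore 0 or at least [1 / q]. *)
Lemma trunc_inv_rat q w z (m : int) : (0 < q)%N -> q%:R * z = m%:~R ->
  trunc_inv w (frac z) <= q%:R / w%:R.
Proof.
move=> q0 qz; rewrite /trunc_inv ge_min; apply/orP; right.
have qR : 0 < q%:R :> R by rewrite ltr0n.
have qf : q%:R * frac z = (m - q%:Z * Num.floor z)%:~R.
  by rewrite intrB intrM /frac mulrBr qz.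
rewrite invfM mulrC ler_wpM2r ?invr_ge0 //.
have := frac_ge0 z; rewrite le_eqVlt => /orP[/eqP <-|f0].
  by rewrite invr0 ltW.
rewrite -[leRHS]invrK lef_pV2 ?posrE ?invr_gt0 //.
rewrite -(ler_pM2l qR) divff ?gt_eqF // qf ler1z.
have : 0 < q%:R * frac z by rewrite mulr_gt0.
by rewrite qf ltr0z.
Qed.

Lemma harm_le_sqrt w : (0 < w)%N -> harm w <= 2 * Num.sqrt w%:R :> R.
Proof.
move=> w0; have w1 : 1 <= w%:R :> R by rewrite ler1n.
have := harm_le_ln w1; rewrite natrK => h; apply: le_trans h _.
have s0 : 0 < Num.sqrt w%:R :> R by rewrite sqrtr_gt0 ltr0n.
have {1}<- : Num.sqrt w%:R ^+ 2 = w%:R :> R by rewrite sqr_sqrtr.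
rewrite expr2 lnM ?posrE //.
have := ln_le_sub1 s0; lra.
Qed.

(** By [trunc_inv_rat] the comparison sum is at most a multiple of [harm w / w]. *)
Lemma psi1_sub_phi1_rational (p q : nat) : (0 < q)%N ->
  let y : R := p%:R / q%:R in
  forall e, 0 < e -> exists N0, forall N, (N0 <= N)%N ->
  `|series (psi1_term y) N - series (phi1_term y) (isqrt (R := R) N)| <= e.
Proof.
move=> q0 y e e0.
have qR : 0 < q%:R :> R by rewrite ltr0n.
pose w0 := (fl ((36 * q%:R / e) ^+ 2)).+1.
exists (w0 ^ 2)%N => N wN.
have w0w : (w0 <= isqrt (R := R) N)%N.
  have /andP[_ h] := isqrtP (R := R) N; rewrite -ltnS -ltn_sqr; exact: leq_ltn_trans h.
apply: le_trans (psi1_sub_phi1 y (isqrtP (R := R) N)) _.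
move: (isqrt N) w0w => w w0w.
have wgt : (0 < w)%N by apply: leq_trans w0w.
have wR : 0 < w%:R :> R by rewrite ltr0n.
have s0 : 0 < Num.sqrt w%:R :> R by rewrite sqrtr_gt0.
have sw : 36 * q%:R / e <= Num.sqrt w%:R.
  rewrite -(@ler_pXn2r _ 2) ?nnegrE ?(ltW s0) //; last by rewrite divr_ge0 ?mulr_ge0 // ltW.
  rewrite sqr_sqrtr; last exact: ltW.
  by apply: le_trans (ltW (truncnS_gt _)) _; rewrite ler_nat.
apply: (@le_trans _ _ (9 * (2 * (q%:R / w%:R) * harm w))).
  rewrite ler_pM2l // mulr_sumr; apply: ler_sum => k _.
  rewrite ler_pM2r ?invr_gt0 // /trunc_inv2.
  have h1 : trunc_inv w (frac (k.+1%:R * y)) <= q%:R / w%:R.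
    apply: (@trunc_inv_rat _ _ _ (k.+1%:Z * p%:Z)) => //.
    by rewrite intrM /y mulrCA [_ * (_ / _)]mulrCA divff ?gt_eqF // mulr1.
  have h2 : trunc_inv w (frac (- (k.+1%:R * y))) <= q%:R / w%:R.
    apply: (@trunc_inv_rat _ _ _ (- (k.+1%:Z * p%:Z))) => //.
    rewrite intrN intrM mulrN /y mulrCA [_ * (_ / _)]mulrCA divff ?gt_eqF //.
    by rewrite mulr1.
  by lra.
apply: (@le_trans _ _ (9 * (2 * (q%:R / w%:R) * (2 * Num.sqrt w%:R)))).
  apply: ler_wpM2l => //; apply: ler_wpM2l; last exact: harm_le_sqrt.
  by rewrite mulr_ge0 // divr_ge0.
have -> : 9 * (2 * (q%:R / w%:R) * (2 * Num.sqrt w%:R)) = 36 * q%:R / Num.sqrt w%:R :> R.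
  rewrite -{1}(sqr_sqrtr (ltW wR)); move: (Num.sqrt _) s0 => s s0.
  by field; rewrite gt_eqF.
by rewrite ler_pdivrMr // [leRHS]mulrC -ler_pdivrMr.
Qed.

Lemma phi1_term0 : phi1_term (0 : R) = fun=> 0.
Proof.
by apply/funext => k; rewrite /phi1_term mulr0 /B1 rpred0 mul0r.
Qed.

(** The iteration of the reciprocity law reaches 0, where [phi1] vanishes
    identically. *)
Lemma rational_point y : rational y -> 0 <= y < 1 ->
  series (phi1_term y) N @[N --> \oo] --> gauss_sum y (depth y) /\
  series (psi1_term y) N @[N --> \oo] --> gauss_sum y (depth y).
Proof.
move=> ry y01; have [a01 aK bK [p [q [q0 yE]]]] := depthP ry y01.
have c1 : series (phi1_term y) N @[N --> \oo] --> gauss_sum y (depth y).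
  apply/cvg_epsP => e e0.
  set c := \sum_(0 <= j < depth y) beta j y / beta j.+1 y.
  have aK1 j : (j < depth y)%N -> 0 < alpha j y <= 1.
    by move=> /a01 /andP[-> /ltW].
  exists (fl (5 * c / e)).+1 => N hN.
  have NR : 0 < N%:R :> R by rewrite ltr0n (leq_trans _ hN).
  have := phi_iterate NR aK1; rewrite aK /phiS natrK phi1_term0.
  have -> n : series (fun=> 0 : R) n = 0 by rewrite /series /= big1.
  rewrite !mulr0 subr0 => h; apply: le_trans h _.
  rewrite -/c mulrAC ler_pdivrMr // -ler_pdivrMl // mulrC.
  by apply: le_trans (ltW (truncnS_gt _)) _; rewrite ler_nat.
split => //; apply/cvg_epsP => e e0.
have e2 : 0 < e / 2 by lra.
have [N1 h1] := psi1_sub_phi1_rational p q0 e2.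
have /cvg_epsP /(_ _ e2) [N2 h2] := c1.
exists (maxn N1 (N2 ^ 2)) => N; rewrite geq_max => /andP[/h1 {}h1 N2N].
have {}h2 : `|series (phi1_term y) (isqrt (R := R) N) - gauss_sum y (depth y)| <= e / 2.
  apply: h2; have /andP[_ h] := isqrtP (R := R) N.
  by rewrite -ltnS -ltn_sqr; exact: leq_ltn_trans h.
move: h1; rewrite -yE => h1.
have -> : series (psi1_term y) N - gauss_sum y (depth y) =
  (series (psi1_term y) N - series (phi1_term y) (isqrt (R := R) N)) +
  (series (phi1_term y) (isqrt (R := R) N) - gauss_sum y (depth y)) by ring.
apply: le_trans (ler_normD _ _) _; lra.
Qed.

End Rational.

(** * Reduction modulo 1 and conclusion *)

Section Periodicity.
Context {R : realType}.
Implicit Types (x y : R).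

Lemma frac_subz x : exists m : int, x = frac x + m%:~R.
Proof. by exists (Num.floor x); rewrite /frac subrK. Qed.

Lemma psi1_term_frac x : psi1_term (frac x) = psi1_term x :> (nat -> R).
Proof.
apply/funext => k; rewrite /psi1_term; congr (_ * (_ * _)).
have [m E] := frac_subz x; rewrite [in RHS]E.
have kE : (k.+1%:Z * m)%:~R = k.+1%:R * m%:~R :> R by rewrite intrM.
have -> : 2 * pi * k.+1%:R * (frac x + m%:~R) =
    2 * pi * (k.+1%:R * frac x + (k.+1%:Z * m)%:~R) by rewrite kE; ring.
by rewrite sin_2piDz; congr sin; ring.
Qed.

Lemma rationalDz y (m : int) : rational y -> rational (y + m%:~R).
Proof. by move=> [r _ <-]; exists (r + m%:~R) => //; rewrite rmorphD /= ratr_int. Qed.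

Lemma rational_frac x : rational (frac x) <-> rational x.
Proof.
split=> [rx|rx]; first by have [m ->] := frac_subz x; exact: rationalDz.
rewrite /frac -intrN; exact: rationalDz.
Qed.

Lemma rationalV y : rational y^-1 -> rational y.
Proof. by move=> [r _ E]; exists r^-1 => //; rewrite fmorphV /= E invrK. Qed.

Lemma alpha_irrational y : ~ rational y -> 0 <= y < 1 ->
  forall j, 0 < alpha j y < 1.
Proof.
move=> ry y01 j.
suff [rj /andP[j0 j1]] : ~ rational (alpha j y) /\ 0 <= alpha j y < 1.
  rewrite lt_neqAle j0 j1 andbT /= andbT; apply/negP => /eqP a0.
  by apply: rj; rewrite -a0; exists 0 => //; rewrite rmorph0.
elim: j => [|j [rj _]]; first by [].
rewrite alphaS frac_ge0 frac_lt1; split => // /rational_frac.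
by move/rationalV.
Qed.

End Periodicity.

Theorem mainTheorem2 (R : realType) :
  [/\ forall x : R,
        (cvgn (series (phi1_term x)) <-> cvgn (series (psi1_term x))) /\
        (cvgn (series (psi1_term x)) <-> cvgn (series (W_term x))),
      forall x : R, cvgn (series (phi1_term x)) ->
        phi1 x = psi1 x /\ psi1 x = - 2^-1 * W x + G x + delta x,
      forall x : R, delta (x + 1) = delta x
    & forall x : R, irrational x -> delta x = 0].
Proof.
suff H (x : R) :
    ((cvgn (series (phi1_term x)) <-> cvgn (series (psi1_term x))) /\
     (cvgn (series (psi1_term x)) <-> cvgn (series (W_term x)))) /\
    (cvgn (series (phi1_term x)) ->
     phi1 x = psi1 x /\ psi1 x = - 2^-1 * W x + G x + delta x).
  split=> [x|x|x|x].
  - by have [] := H x.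
  - by have [] := H x.
  - by rewrite /delta -[1]/(1%:~R) fracDz.
  - move=> rx; rewrite /delta; case: asboolP => // h; exfalso.
    by apply: rx; exact/rational_frac.
have y01 : 0 <= frac x < 1 by rewrite frac_ge0 frac_lt1.
have [ry|ry] := pselect (rational (frac x)); last first.
  have [] := irrational_point (alpha_irrational ry y01).
  have WE : W_term x = fun k => (-1) ^+ k * gamma k (frac x).
    by apply/funext => k; rewrite /W_term; case: asboolP.
  rewrite phi1_term_frac psi1_term_frac -WE => h1 h2 h3; split; first by tauto.
  rewrite /phi1 /psi1 /W /G /delta asboolF // addr0.
  move: h3; rewrite /phi1 /psi1 phi1_term_frac psi1_term_frac => h3 /h3 [-> ->].
  by split => //; ring.
have [c1 c2] := rational_point ry y01.
have [_ _ bK _] := depthP ry y01.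
set K := depth (frac x) in c1 c2 bK.
set gs := series (fun k => (-1) ^+ k * gamma k (frac x)) K.
have cW : series (W_term x) N @[N --> \oo] --> gs.
  apply/cvg_epsP => e e0; exists K => N KN.
  rewrite [_ - _](_ : _ = 0) ?normr0 ?ltW //; apply/eqP; rewrite subr_eq0; apply/eqP.
  rewrite /gs /series /= (big_cat_nat _ KN) //= [X in _ + X]big_nat_cond.
  rewrite [X in _ + X]big1 ?addr0; last first.
    by move=> k /andP[/andP[Kk _] _]; rewrite /W_term asboolT // Kk.
  apply: eq_big_nat => k /andP[_ kK].
  by rewrite /W_term asboolT // leqNgt kK.
move: c1 c2; rewrite phi1_term_frac psi1_term_frac => c1 c2.
have d1 : cvgn (series (phi1_term x)) by apply/cvg_ex; eexists; exact: c1.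
have d2 : cvgn (series (psi1_term x)) by apply/cvg_ex; eexists; exact: c2.
have d3 : cvgn (series (W_term x)) by apply/cvg_ex; eexists; exact: cW.
split; first by split; split.
move=> _; rewrite /phi1 /psi1 /W.
rewrite (cvg_lim _ c1) // (cvg_lim _ c2) // (cvg_lim _ cW) //; split => //.
have [_ aK _ _] := depthP ry y01.
rewrite /G /delta !asboolT // -/K -(big_mkord xpredT (G_term (frac x))).
rewrite big_nat_recr //= /G_term aK bK /F eqxx /gauss_sum -/gs /series /= exprS.
by rewrite invfM; ring.
Qed.
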